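(* Let $n\geq 3$. For any pair $(\Gamma,\Gamma')$ of triangulations of the reference $n$-gon, the potential functions $\mathfrak{PO}_\Gamma$ and $\mathfrak{PO}_{\Gamma'}$ are related by a subtraction-free rational change of variables obtained as the geometric lift of the piecewise-linear transformation $T_{\Gamma,\Gamma'}$ (which maps $\Delta_{\Gamma'}$ onto $\Delta_\Gamma$): substituting this change of variables (expressing the variables for $\Gamma$ through those for $\Gamma'$) into $\mathfrak{PO}_\Gamma$ gives $\mathfrak{PO}_{\Gamma'}$.
   Context: **Triangulations.** The reference polygon $P$ is a convex planar $n$-gon with sides $e_1,\dots,e_n$ in cyclic order; a triangulation $\Gamma$ is given by $n-3$ pairwise non-crossing diagonals $d_1,\dots,d_{n-3}$; $I_\alpha\subset\{1,\dots,n\}$ indexes the sides on one chosen side of $d_\alpha$. Fix $|r|>0$. For coordinates $(u_{e_1},\dots,u_{e_{n-1}},u_{d_1},\dots,u_{d_{n-3}})$ on $\mathbb R^{2n-4}$ set $u_{e_n}=2|r|-\sum_{i<n}u_{e_i}$, $u(e_i)=\frac12u_{e_i}$ ($1\le i\le n$) and $u(d_\alpha)=-u_{d_\alpha}+\frac12\sum_{i\in I_\alpha}u_{e_i}$. $\Delta_\Gamma$ is the polytope given by the triangle inequalities $|u(a)-u(b)|\le u(c)\le u(a)+u(b)$ for all triangles of $\Gamma$ with edges $a,b,c$. **The transformation $T_{\Gamma,\Gamma'}$.** Suppose $\Gamma_2$ is obtained from $\Gamma_1$ by a Whitehead move: in a quadrilateral with sides $a_1,a_2,a_3,a_4$ (in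 cyclic order, each a side of $P$ or a common diagonal) the diagonal $d$ (forming triangles $\{a_1,a_2,d\}$, $\{a_3,a_4,d\}$) is replaced by the other diagonal $d'$ (forming triangles $\{a_2,a_3,d'\}$, $\{a_1,a_4,d'\}$). Then the transformation $T_{\Gamma_2,\Gamma_1}$ fixes all other length coordinates $u(a)$ and, with $u_i=u(a_i)$, sets $$u(d')=u(d)-\min(u_1+u_2,u_3+u_4)+\min(u_1+u_4,u_2+u_3);$$ it maps $\Delta_{\Gamma_1}$ onto $\Delta_{\Gamma_2}$. For general $\Gamma,\Gamma'$, one connects $\Gamma'$ to $\Gamma$ by a sequence of Whitehead moves, and $T_{\Gamma,\Gamma'}$ is the composition of the corresponding transformations. **Geometric lift** (Berenstein–Zelevinsky): the rational map obtained from a piecewise-linear map by replacing summation, subtraction and minimum by multiplication, division and summation, respectively, with the variable $y(a)$ corresponding to $u(a)$; the lift of a composition is taken to be the composition of the lifts. **Potential functions.** $\mathfrak{PO}_\Gamma$ is the potential function (in the sense of Fukaya–Oh–Ohta–Ono) of the Lagrangian torus fibers of the integrable system $\Psi_\Gamma$ on $\mathrm{Gr}(2,n)$, which is given by $$\mathfrak{PO}_\Gamma=\sum_{\text{triangles }\{a,b,c\}\text{ of }\Gamma}\left(\frac{y(b)y(c)}{y(a)}+\frac{y(a)y(c)}{y(b)}+\frac{y(a)y(b)}{y(c)}\right),$$ where $y(e_i)=y_{e_i}^{1/2}$ ($1\le i\le n-1$), $y(e_n)=Q(y_{e_1}\cdots y_{e_{n-1}})^{-1/2}$ (also denoted $y_{e_n}^{1/2}$),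 $y(d_\alpha)=y_{d_\alpha}^{-1}\prod_{i\in I_\alpha}y_{e_i}^{1/2}$, with $y_a$ the torus variables and $Q=T^{|r|}$ the Novikov parameter. *)

(* Defs.v *)
From HB Require Import structures.
From mathcomp Require Import all_boot all_order all_algebra.
From mathcomp Require Import mpoly.

Set Implicit Arguments.
Unset Strict Implicit.
Unset Printing Implicit Defensive.

Import Order.TTheory GRing.Theory Num.Theory.
Local Open Scope ring_scope.

(* The vertices of the n-gon are the elements of 'I_n in cyclic order; sides
   and diagonals are two-element sets of vertices.  The 0-based index i stands
   for the side e_(i+1), which joins the vertices i and i+1 mod n; thus e_n is
   the side whose index i satisfies i.+1 = n. *)
Definition side (n : nat) (i : 'I_n) : {set 'I_n} := [set i; ordS i].

Definition sides (n : nat) : {set {set 'I_n}} := [set side i | i : 'I_n].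

Definition diagonal (n : nat) (a : {set 'I_n}) : bool :=
  (#|a| == 2)%N && (a \notin sides n).

Definition crossing (n : nat) (a b : {set 'I_n}) : bool :=
  [exists i : 'I_n, exists j : 'I_n, exists k : 'I_n, exists l : 'I_n,
    [&& (i < j)%N, (j < k)%N, (k < l)%N &
        ((a == [set i; k]) && (b == [set j; l]))
        || ((b == [set i; k]) && (a == [set j; l]))]].

Definition triangulation (n : nat) (G : {set {set 'I_n}}) : bool :=
  [&& [forall a in G, diagonal a],
      [forall a in G, forall b in G, ~~ crossing a b] &
      (#|G| == n - 3)%N].

Definition edges (n : nat) (G : {set {set 'I_n}}) : {set {set 'I_n}} :=
  sides n :|: G.

(* As no vertex lies inside a triangle spanned by three vertices, three
   vertices joined pairwise by edges of a triangulation bound one of its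
   triangles. *)
Definition triangle (n : nat) (G : {set {set 'I_n}}) (i j k : 'I_n) : bool :=
  [&& uniq [:: i; j; k], [set i; j] \in edges G, [set j; k] \in edges G
    & [set i; k] \in edges G].

(* I d is (the set of indices of) the sides of the polygon on one of the two
   sides of the diagonal d, chosen arbitrarily for each d in G. *)
Definition side_choice (n : nat) (G : {set {set 'I_n}})
    (I : {set 'I_n} -> {set 'I_n}) : Prop :=
  forall i j : 'I_n, (i < j)%N -> [set i; j] \in G ->
    I [set i; j] = [set k : 'I_n | (i <= k < j)%N] \/
    I [set i; j] = ~: [set k : 'I_n | (i <= k < j)%N].

(* e_1, ..., e_(n-1) and the diagonals: the index set of the 2n-4 coordinates *)
Definition cvars (n : nat) (G : {set {set 'I_n}}) : {set {set 'I_n}} :=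
  [set side i | i : 'I_n & (i.+1 < n)%N] :|: G.

Definition cvar (n : nat) (G : {set {set 'I_n}}) : finType :=
  {a : {set 'I_n} | a \in cvars G}.

(* the coordinate of x along a, with a junk value if a is not a coordinate *)
Definition coord_at (n : nat) (G : {set {set 'I_n}}) (V : nmodType)
    (x : {ffun cvar G -> V}) (a : {set 'I_n}) : V :=
  if insub a is Some v then x v else 0.

(* u_{e_(i+1)}, where r stands for |r| *)
Definition u_side (n : nat) (R : realFieldType) (r : R)
    (G : {set {set 'I_n}}) (x : {ffun cvar G -> R}) (i : 'I_n) : R :=
  if (i.+1 < n)%N then coord_at x (side i)
  else 2%:R * r - \sum_(j < n | (j.+1 < n)%N) coord_at x (side j).

(* u(a) *)
Definition u_edge (n : nat) (R : realFieldType) (r : R)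
    (G : {set {set 'I_n}}) (I : {set 'I_n} -> {set 'I_n})
    (x : {ffun cvar G -> R}) (a : {set 'I_n}) : R :=
  if [pick i | a == side i] is Some i then 2%:R^-1 * u_side r x i
  else - coord_at x a + 2%:R^-1 * \sum_(i in I a) u_side r x i.

(* the inverse of u_edge: the coordinates of the point with prescribed u(a) *)
Definition u_coords (n : nat) (R : realFieldType)
    (G : {set {set 'I_n}}) (I : {set 'I_n} -> {set 'I_n})
    (u : {set 'I_n} -> R) : {ffun cvar G -> R} :=
  [ffun v : cvar G => if val v \in sides n then 2%:R * u (val v)
                      else - u (val v) + \sum_(i in I (val v)) u (side i)].

Definition in_polytope (n : nat) (R : realFieldType) (r : R)
    (G : {set {set 'I_n}}) (I : {set 'I_n} -> {set 'I_n})
    (x : {ffun cvar G -> R}) : Prop :=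
  let u := u_edge r I x in
  forall i j k : 'I_n, triangle G i j k ->
    `|u [set i; j] - u [set j; k]| <= u [set i; k]
      <= u [set i; j] + u [set j; k].

(* Points of the torus are given by y_{e_1}^{1/2}, ..., y_{e_(n-1)}^{1/2} and
   the y_d, d a diagonal: the component of y at a side e_i is the square root
   y_{e_i}^{1/2} = y(e_i), and not y_{e_i} itself.  In the same way y_side is
   y_{e_(i+1)}^{1/2}, for all n sides. *)
Definition y_side (n : nat) (K : fieldType) (Q : K)
    (G : {set {set 'I_n}}) (y : {ffun cvar G -> K}) (i : 'I_n) : K :=
  if (i.+1 < n)%N then coord_at y (side i)
  else Q / \prod_(j < n | (j.+1 < n)%N) coord_at y (side j).

(* y(a) *)
Definition y_edge (n : nat) (K : fieldType) (Q : K)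
    (G : {set {set 'I_n}}) (I : {set 'I_n} -> {set 'I_n})
    (y : {ffun cvar G -> K}) (a : {set 'I_n}) : K :=
  if [pick i | a == side i] is Some i then y_side Q y i
  else (coord_at y a)^-1 * \prod_(i in I a) y_side Q y i.

(* the inverse of y_edge *)
Definition y_coords (n : nat) (K : fieldType)
    (G : {set {set 'I_n}}) (I : {set 'I_n} -> {set 'I_n})
    (Y : {set 'I_n} -> K) : {ffun cvar G -> K} :=
  [ffun v : cvar G => if val v \in sides n then Y (val v)
                      else (Y (val v))^-1 * \prod_(i in I (val v)) Y (side i)].

(* Each unordered triple of vertices is counted once, as i < j < k. *)
Definition potential (n : nat) (K : fieldType) (Q : K)
    (G : {set {set 'I_n}}) (I : {set 'I_n} -> {set 'I_n})
    (y : {ffun cvar G -> K}) : K :=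
  \sum_(i < n) \sum_(j < n) \sum_(k < n | [&& (i < j)%N, (j < k)%N
                                            & triangle G i j k])
    let a := y_edge Q I y [set i; j] in
    let b := y_edge Q I y [set j; k] in
    let c := y_edge Q I y [set i; k] in
    b * c / a + a * c / b + a * b / c.

Inductive plexpr (V : Type) : Type :=
  | PLVar of V
  | PLAdd of plexpr V & plexpr V
  | PLSub of plexpr V & plexpr V
  | PLMin of plexpr V & plexpr V.

Fixpoint pl_eval (V : Type) (R : realFieldType) (u : V -> R)
    (e : plexpr V) : R :=
  match e with
  | PLVar v => u v
  | PLAdd e1 e2 => pl_eval u e1 + pl_eval u e2
  | PLSub e1 e2 => pl_eval u e1 - pl_eval u e2
  | PLMin e1 e2 => Num.min (pl_eval u e1) (pl_eval u e2)
  end.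

Fixpoint lift_eval (V : Type) (K : fieldType) (y : V -> K)
    (e : plexpr V) : K :=
  match e with
  | PLVar v => y v
  | PLAdd e1 e2 => lift_eval y e1 * lift_eval y e2
  | PLSub e1 e2 => lift_eval y e1 / lift_eval y e2
  | PLMin e1 e2 => lift_eval y e1 + lift_eval y e2
  end.

(* No division by 0 occurs in the evaluation of the lift of e at y. *)
Fixpoint lift_defined (V : Type) (K : fieldType) (y : V -> K)
    (e : plexpr V) : bool :=
  match e with
  | PLVar v => true
  | PLAdd e1 e2 => lift_defined y e1 && lift_defined y e2
  | PLSub e1 e2 =>
      [&& lift_defined y e1, lift_defined y e2 & lift_eval y e2 != 0]
  | PLMin e1 e2 => lift_defined y e1 && lift_defined y e2
  end.

Fixpoint pl_subst (V W : Type) (s : V -> plexpr W) (e : plexpr V) : plexpr W :=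
  match e with
  | PLVar v => s v
  | PLAdd e1 e2 => PLAdd (pl_subst s e1) (pl_subst s e2)
  | PLSub e1 e2 => PLSub (pl_subst s e1) (pl_subst s e2)
  | PLMin e1 e2 => PLMin (pl_subst s e1) (pl_subst s e2)
  end.

(* The crossing condition says that v1, v2, v3, v4 are in cyclic order, for
   one of the two orientations of the polygon. *)
Definition whitehead_move (n : nat) (G1 G2 : {set {set 'I_n}})
    (v1 v2 v3 v4 : 'I_n) : bool :=
  [&& crossing [set v1; v3] [set v2; v4],
      [set v1; v3] \in G1,
      G2 == [set v2; v4] |: (G1 :\ [set v1; v3]) &
      [&& [set v1; v2] \in edges (G1 :&: G2), [set v2; v3] \in edges (G1 :&: G2),
          [set v3; v4] \in edges (G1 :&: G2) & [set v4; v1] \in edges (G1 :&: G2)]].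

Definition whitehead_map (n : nat) (v1 v2 v3 v4 : 'I_n) (a : {set 'I_n}) :
    plexpr {set 'I_n} :=
  let u1 := PLVar [set v1; v2] in
  let u2 := PLVar [set v2; v3] in
  let u3 := PLVar [set v3; v4] in
  let u4 := PLVar [set v4; v1] in
  if a == [set v2; v4] then
    PLAdd (PLSub (PLVar [set v1; v3]) (PLMin (PLAdd u1 u2) (PLAdd u3 u4)))
          (PLMin (PLAdd u1 u4) (PLAdd u2 u3))
  else PLVar a.

(* transformation G' G T: T is a transformation T_{G,G'}, i.e. the composition
   of the transformations of the steps of some sequence of Whitehead moves
   leading from G' to G.  It expresses u(a), for a an edge of G, through the
   u(b), for b an edge of G'; the values of T outside the edges of G are
   irrelevant. *)
Inductive transformation (n : nat) (G' : {set {set 'I_n}}) :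
    {set {set 'I_n}} -> ({set 'I_n} -> plexpr {set 'I_n}) -> Prop :=
  | transformation_id : transformation G' G' (@PLVar {set 'I_n})
  | transformation_move (G1 G2 : {set {set 'I_n}})
      (T : {set 'I_n} -> plexpr {set 'I_n}) (v1 v2 v3 v4 : 'I_n) :
      transformation G' G1 T -> whitehead_move G1 G2 v1 v2 v3 v4 ->
      transformation G' G2 (fun a => pl_subst T (whitehead_map v1 v2 v3 v4 a)).

(* T as a map from the coordinates of G' to those of G *)
Definition pl_map (n : nat) (R : realFieldType) (r : R)
    (G' G : {set {set 'I_n}}) (I' I : {set 'I_n} -> {set 'I_n})
    (T : {set 'I_n} -> plexpr {set 'I_n}) (x : {ffun cvar G' -> R}) :
    {ffun cvar G -> R} :=
  u_coords G I (fun a => pl_eval (u_edge r I' x) (T a)).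

(* the geometric lift of T, giving the torus variables of G in terms of those
   of G' *)
Definition lift_map (n : nat) (K : fieldType) (Q : K)
    (G' G : {set {set 'I_n}}) (I' I : {set 'I_n} -> {set 'I_n})
    (T : {set 'I_n} -> plexpr {set 'I_n}) (y : {ffun cvar G' -> K}) :
    {ffun cvar G -> K} :=
  y_coords G I (fun a => lift_eval (y_edge Q I' y) (T a)).

(* F(y_{e_1}^{1/2}, ..., y_{e_(n-1)}^{1/2}, y_{d_1}, ..., y_{d_(n-3)}) *)
Definition ratfun (n : nat) (F : fieldType) (G : {set {set 'I_n}}) : fieldType :=
  {fraction {mpoly F[#|cvar G|]}}.

Definition ratconst (n : nat) (F : fieldType) (G : {set {set 'I_n}}) (c : F) :
    ratfun F G :=
  tofrac (c%:MP_[#|cvar G|]).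

Definition ratvars (n : nat) (F : fieldType) (G : {set {set 'I_n}}) :
    {ffun cvar G -> ratfun F G} :=
  [ffun v : cvar G => tofrac ('X_(enum_rank v) : {mpoly F[#|cvar G|]})].

(* Main.v *)
Require Import Defs.
From mathcomp Require Import all_boot all_order all_algebra.
From mathcomp Require Import fieldext mpoly.
From Stdlib Require Classical_Prop.
From mathcomp Require Import zify ring lra.

Set Implicit Arguments.
Unset Strict Implicit.
Unset Printing Implicit Defensive.

Import Order.TTheory GRing.Theory Num.Theory.
Local Open Scope ring_scope.

(** Any triangulation that is not the fan at vertex 0 admits a Whitehead move
    that adds a diagonal at vertex 0, and moves are reversible; so any two
    triangulations are connected by moves, and the transformation along the
    reversed path undoes the one along the path.  A single move only affects
    the two triangles of its quadrilateral, where the triangle inequalities and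
    the invariance of the potential are direct computations.

    The delicate point is that the lifts never divide by zero, which is not
    obvious in positive characteristic.  It is proved by specializing the torus
    variables to a single point that all Whitehead maps respect and at which no
    denominator vanishes: y({i, j}) = z / (t^j - t^i) for i < j.  By the second
    theorem of Ptolemy the diagonals of a cyclic quadrilateral with sides a, b,
    c, d are in the ratio (ad + bc) : (ab + cd), and the differences x_j - x_i
    of points on a line satisfy the same relation; passing to reciprocals turns
    it into the lifted Whitehead move.  The scaling factor z, an n-th root
    adjoined to F(t), makes the product of the side variables equal to Q. *)

(** * Crossings and Whitehead moves *)

Lemma set2_eq (T : finType) (a b c d : T) :
  ([set a; b] == [set c; d]) =
  ((a == c) && (b == d)) || ((a == d) && (b == c)).
Proof.
apply/eqP/idP => [E|/orP[]/andP[/eqP-> /eqP->] //]; last by rewrite setUC.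
move/setP: E => E; move: (E a) (E b) (E c) (E d); rewrite !inE !eqxx ?orbT /=.
rewrite (eq_sym c a) (eq_sym c b) (eq_sym d a) (eq_sym d b).
by do 4!case: eqP.
Qed.

(** Turns the existential definition into linear arithmetic on vertex numbers: one endpoint strictly
    inside the interval spanned by the other pair, one strictly outside. *)
Lemma crossingE (n : nat) (a b c d : 'I_n) :
  crossing [set a; b] [set c; d] =
  [|| [&& minn a b < c, c < maxn a b & (d < minn a b) || (maxn a b < d)]
    | [&& minn a b < d, d < maxn a b & (c < minn a b) || (maxn a b < c)]]%N.
Proof.
apply/idP/idP.
  case/existsP=> i /existsP[j /existsP[k /existsP[l]]].
  rewrite !set2_eq -!val_eqE /=; lia.
move=> H; pose x := if (a < b)%N then a else b; pose y := if (a < b)%N then b else a.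
pose z := if (c < d)%N then c else d; pose t := if (c < d)%N then d else c.
have [xz|zx] := ltnP x z.
  apply/existsP; exists x; apply/existsP; exists z; apply/existsP; exists y.
  apply/existsP; exists t; rewrite !set2_eq -!val_eqE /=; move: H xz; rewrite /x /y /z /t.
  case: ifP; case: ifP; lia.
apply/existsP; exists z; apply/existsP; exists x; apply/existsP; exists t.
apply/existsP; exists y; rewrite !set2_eq -!val_eqE /=; move: H zx; rewrite /x /y /z /t.
case: ifP; case: ifP; lia.
Qed.

Lemma crossingC (n : nat) (a b : {set 'I_n}) : crossing a b = crossing b a.
Proof.
by apply: eq_existsb => i; apply: eq_existsb => j; apply: eq_existsb => k;
   apply: eq_existsb => l; rewrite orbC.
Qed.

Lemma crossing_pair (n : nat) (a b : {set 'I_n}) : crossing a b ->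
  exists i j, b = [set i; j].
Proof.
case/existsP=> i /existsP[j /existsP[k /existsP[l]]] /and4P[_ _ _].
by case/orP=> /andP[h1 h2]; do 2!eexists; apply/eqP; [exact: h2|exact: h1].
Qed.

Lemma val_ordS (n : nat) (i : 'I_n) :
  (ordS i : nat) = if (i.+1 < n)%N then i.+1 else 0%N.
Proof.
rewrite /=; case: ltnP => [/modn_small //|ni].
by have ->: i.+1 = n by [have := ltn_ord i; lia]; rewrite modnn.
Qed.

Lemma side_in (n : nat) (i : 'I_n) : side i \in sides n.
Proof. exact: imset_f. Qed.

(** No vertex lies strictly between [i] and [i.+1], and none lies outside the interval spanned by
    the closing side [{n-1, 0}]. *)
Lemma side_noncrossing (n : nat) (a b : {set 'I_n}) :
  a \in sides n -> ~~ crossing a b.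
Proof.
case/imsetP=> i _ ->; apply/negP => h; have [c [d E]] := crossing_pair h.
move: h; rewrite {}E /side crossingE val_ordS.
have := ltn_ord c; have := ltn_ord d; have := ltn_ord i; case: ifP; lia.
Qed.

Lemma sub_edges (n : nat) (G1 G2 : {set {set 'I_n}}) :
  G1 \subset G2 -> edges G1 \subset edges G2.
Proof. exact: setUS. Qed.

Lemma edges_noncrossing (n : nat) (G : {set {set 'I_n}}) (a b : {set 'I_n}) :
  triangulation G -> a \in edges G -> b \in edges G -> ~~ crossing a b.
Proof.
case/and3P=> _ /forall_inP nc _; rewrite !in_setU.
case/orP=> [sa _|Ga]; first exact: side_noncrossing.
case/orP=> [sb|Gb]; first by rewrite crossingC side_noncrossing.
by have /forall_inP := nc _ Ga; apply.
Qed.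

Lemma card_side (n : nat) (i : 'I_n) : (1 < n)%N -> #|side i| = 2%N.
Proof.
move=> n1; rewrite cards2; suff -> : i != ordS i by [].
by apply/eqP => E; have := val_ordS i; rewrite -E; case: ifP; lia.
Qed.

Lemma card_edge (n : nat) (G : {set {set 'I_n}}) (a : {set 'I_n}) :
  (1 < n)%N -> triangulation G -> a \in edges G -> #|a| = 2%N.
Proof.
move=> n1 /and3P[/forall_inP hG _ _]; rewrite in_setU.
case/orP=> [/imsetP[i _ ->]|/hG /andP[/eqP]] //; exact: card_side.
Qed.

Lemma diag_not_side (n : nat) (G : {set {set 'I_n}}) (a : {set 'I_n}) :
  triangulation G -> a \in G -> a \notin sides n.
Proof. by case/and3P=> /forall_inP h _ _ /h /andP[]. Qed.

(** The disjuncts are the four rotations of [a < b < c < d] and the four of its reversal, so each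
    case is a single chain for linear arithmetic. *)
Definition cyclic4 (n : nat) (a b c d : 'I_n) : bool :=
  [|| (a < b < c) && (c < d), (b < c < d) && (d < a), (c < d < a) && (a < b)
    , (d < a < b) && (b < c), (d < c < b) && (b < a), (a < d < c) && (c < b)
    , (b < a < d) && (d < c) | (c < b < a) && (a < d)]%N.

Lemma crossing_cyclic4 (n : nat) (a b c d : 'I_n) :
  crossing [set a; c] [set b; d] = cyclic4 a b c d.
Proof.
rewrite crossingE /cyclic4; apply/idP/idP.
  by case/orP=> /and3P[h1 h2 /orP[h3|h3]]; move: h1 h2 h3;
     rewrite /minn /maxn; case: (ltnP a c); lia.
by do 7?[case/orP=> [/andP[/andP[h1 h2] h3]|]; first by clear -h1 h2 h3; lia]; lia.
Qed.

Ltac cyclic_cases :=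
  let H := fresh "H" in let H' := fresh "H'" in let H'' := fresh "H''" in
  rewrite /cyclic4 => /orP[|/orP[|/orP[|/orP[|/orP[|/orP[|/orP[]]]]]]]
    /andP[/andP[H H'] H''].

(** A chord crossing [{b, d}] meets the interior of the quadrilateral; if it crosses no side, it can
    leave only through the corners [a] and [c]. *)
Lemma crossing_quadrilateral (n : nat) (a b c d i j : 'I_n) :
  cyclic4 a b c d -> crossing [set i; j] [set b; d] ->
  ~~ crossing [set i; j] [set a; b] -> ~~ crossing [set i; j] [set b; c] ->
  ~~ crossing [set i; j] [set c; d] -> ~~ crossing [set i; j] [set d; a] ->
  [set i; j] = [set a; c].
Proof.
wlog ij : i j / (i <= j)%N.
  move=> h; have [|/ltnW ji] := leqP i j; first exact: h.
  by rewrite setUC; apply: h.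
rewrite !crossingE (minn_idPl ij) (maxn_idPr ij) => cyc h h1 h2 h3 h4.
apply/eqP; rewrite set2_eq -!val_eqE /=; move: cyc h h1 h2 h3 h4.
by cyclic_cases => /orP[] /and3P[k1 k2 /orP[]k3] h1 h2 h3 h4; lia.
Qed.

Section Whitehead.
Variables (n : nat) (G1 G2 : {set {set 'I_n}}) (v1 v2 v3 v4 : 'I_n).
Hypothesis W : whitehead_move G1 G2 v1 v2 v3 v4.

Lemma whitehead_cyclic : cyclic4 v1 v2 v3 v4.
Proof. by case/and4P: W; rewrite crossing_cyclic4. Qed.

Lemma whitehead_neq : [/\ v1 != v2, v1 != v3, v1 != v4 &
  [/\ v2 != v3, v2 != v4 & v3 != v4]].
Proof.
by have := whitehead_cyclic; rewrite -!val_eqE /=; cyclic_cases; (split; [..|split]); lia.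
Qed.

Lemma whitehead_old : [set v1; v3] \in G1.
Proof. by case/and4P: W. Qed.

Lemma whitehead_new : [set v2; v4] \in G2.
Proof. by case/and4P: W => _ _ /eqP-> _; rewrite setU11. Qed.

Lemma whitehead_old_side : [set v1; v3] \notin sides n.
Proof.
by apply: contraL whitehead_cyclic => /side_noncrossing; rewrite -crossing_cyclic4; apply.
Qed.

Lemma whitehead_new_side : [set v2; v4] \notin sides n.
Proof.
apply: contraL whitehead_cyclic => /side_noncrossing.
by rewrite -crossing_cyclic4 crossingC; apply.
Qed.

Lemma whitehead_new_old : triangulation G1 -> [set v2; v4] \notin edges G1.
Proof.
move=> tG; apply: contraL whitehead_cyclic => h.
rewrite -crossing_cyclic4 (edges_noncrossing tG) //.
by rewrite in_setU whitehead_old orbT.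
Qed.

Lemma whitehead_edge (a : {set 'I_n}) :
  (a \in edges G2) = (a == [set v2; v4]) || (a != [set v1; v3]) && (a \in edges G1).
Proof.
case/and4P: W => _ _ /eqP-> _; rewrite !inE.
case: (altP eqP) => //= [->|_]; first by rewrite orbT.
by case: (altP eqP) => //= ->; rewrite (negPf whitehead_old_side).
Qed.

Lemma whitehead_quad : forall a,
  a \in [:: [set v1; v2]; [set v2; v3]; [set v3; v4]; [set v4; v1]] ->
  [/\ a \in edges G1, a \in edges G2, a != [set v1; v3] & a != [set v2; v4]].
Proof.
case/and4P: W => _ _ _ /and4P[h1 h2 h3 h4] a ha.
have: a \in edges (G1 :&: G2).
  by move: ha; rewrite !in_cons orbF => /or4P[]/eqP->.
move=> h; split.
- exact: (subsetP (sub_edges (subsetIl G1 G2))).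
- exact: (subsetP (sub_edges (subsetIr G1 G2))).
- move: ha; rewrite !in_cons orbF => /or4P[]/eqP->; rewrite set2_eq;
  case: whitehead_neq => n1 n2 n3 [n4 n5 n6];
  by move: n1 n2 n3 n4 n5 n6; rewrite -!val_eqE /=; lia.
move: ha; rewrite !in_cons orbF => /or4P[]/eqP->; rewrite set2_eq;
  case: whitehead_neq => n1 n2 n3 [n4 n5 n6];
  by move: n1 n2 n3 n4 n5 n6; rewrite -!val_eqE /=; lia.
Qed.

(** A diagonal of [G1] that crosses the new one but no side of the quadrilateral is the old one. The
    cardinality is kept because the new diagonal crosses the old one and so was absent. *)
Lemma whitehead_triangulation : (1 < n)%N -> triangulation G1 -> triangulation G2.
Proof.
move=> n1 tG.
have nc a : a \in G1 -> a != [set v1; v3] -> ~~ crossing [set v2; v4] a.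
  move=> aG ad; apply/negP => cr; have [i [j E]] := crossing_pair cr.
  have aE : a \in edges G1 by rewrite in_setU aG orbT.
  have h b : b \in [:: [set v1; v2]; [set v2; v3]; [set v3; v4]; [set v4; v1]] ->
      ~~ crossing b a.
    by case/whitehead_quad => bG *; apply: (edges_noncrossing tG).
  move: ad; rewrite E; apply/negP; rewrite negbK; apply/eqP.
  by apply: (crossing_quadrilateral whitehead_cyclic);
     rewrite -?E crossingC // h // !inE eqxx ?orbT.
have old_new : [set v2; v4] \notin G1.
  by apply: contra (whitehead_new_old tG); rewrite in_setU orbC => ->.
have /and4P[_ _ /eqP EG2 _] := W.
have /and3P[/forall_inP dG /forall_inP ncG /eqP cG] := tG.
apply/and3P; split.
- apply/forall_inP => a; rewrite EG2 !inE => /orP[/eqP->|/andP[_ /dG //]].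
  rewrite /diagonal whitehead_new_side cards2.
  by case: whitehead_neq => _ _ _ [_ -> _].
- apply/forall_inP => a aG; apply/forall_inP => b; move: aG.
  rewrite EG2 !inE => /orP[/eqP->|/andP[ad aG]] /orP[/eqP->|/andP[bd bG]].
  + by rewrite crossingE; clear; lia.
  + exact: nc.
  + by rewrite crossingC nc.
  + by have /forall_inP := ncG _ aG; apply.
- rewrite EG2 cardsU1 !inE (negPf old_new) andbF /=.
  by rewrite -cG (cardsD1 [set v1; v3] G1) whitehead_old.
Qed.

(** The reverse move takes place in the same quadrilateral, read from [v2] on. *)
Lemma whitehead_sym : triangulation G1 -> whitehead_move G2 G1 v2 v3 v4 v1.
Proof.
move=> tG; have /and4P[cr old /eqP EG2 /and4P[h1 h2 h3 h4]] := W.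
rewrite /whitehead_move (setUC [set v3]) crossingC cr whitehead_new setIC h2 h3 h4 h1 /= andbT.
rewrite EG2; apply/eqP/setP => a; rewrite !inE.
case: (altP eqP) => [->//|/= _].
case: (altP eqP) => //= -> .
by apply: contraTF (whitehead_new_old tG); rewrite in_setU orbC => ->.
Qed.

End Whitehead.

Lemma transformation_triangulation (n : nat) (G' G : {set {set 'I_n}}) T :
  (1 < n)%N -> triangulation G' -> transformation G' G T -> triangulation G.
Proof.
by move=> n1 tG'; elim=> // G1 G2 T1 v1 v2 v3 v4 _ tG1 /whitehead_triangulation; apply.
Qed.

(** * Substitution and composition of transformations *)

Lemma pl_subst_var (V : Type) (e : plexpr V) : pl_subst (@PLVar V) e = e.
Proof. by elim: e => //= e1 -> e2 ->. Qed.

Lemma eq_pl_subst (V W : Type) (s t : V -> plexpr W) (e : plexpr V) :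
  s =1 t -> pl_subst s e = pl_subst t e.
Proof. by move=> st; elim: e => [v|||] //= e1 -> e2 ->. Qed.

Lemma pl_substA (U V W : Type) (s : U -> plexpr V) (t : V -> plexpr W)
    (e : plexpr U) :
  pl_subst t (pl_subst s e) = pl_subst (fun v => pl_subst t (s v)) e.
Proof. by elim: e => [v|||] //= e1 -> e2 ->. Qed.

(** Concatenates two paths of moves. The composite is described pointwise because substitutions
    reassociate only up to extensional equality. *)
Lemma transformation_trans (n : nat) (G1 G2 G3 : {set {set 'I_n}}) T1 T2 :
  transformation G1 G2 T1 -> transformation G2 G3 T2 ->
  exists2 T, transformation G1 G3 T & forall a, T a = pl_subst T1 (T2 a).
Proof.
move=> h1; elim=> [|H1 H2 T v1 v2 v3 v4 _ [T' hT' ET'] W]; first by exists T1.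
exists (fun a => pl_subst T' (whitehead_map v1 v2 v3 v4 a)).
  exact: transformation_move hT' W.
by move=> a; rewrite pl_substA; apply: eq_pl_subst.
Qed.

(** * Flip-connectedness of triangulations *)

Section NoncrossingArcs.
Variables (n : nat) (A : {set 'I_n * 'I_n}).
Hypothesis A_long : forall p, p \in A -> (p.1.+1 < p.2)%N.
Hypothesis A_noncrossing : forall p q, p \in A -> q \in A ->
  ~~ [&& p.1 < q.1, q.1 < p.2 & p.2 < q.2]%N.

Definition arcs_within (i j : nat) : {set 'I_n * 'I_n} :=
  [set p in A | (i <= p.1)%N && (p.2 <= j)%N].

(** For [j > i.+1], the polygon on [i, ..., j] has at most [j - i - 2] non-crossing diagonals, and
    its closing arc [{i, j}] is counted too. Reaching the bound means that this polygon is
    triangulated. *)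
Definition full (i j : nat) : bool := (#|arcs_within i j| == j - i - 1)%N.

(* The splitting vertex m is the last one before j which i sees along an arc
   or a side. *)
Lemma arcs_within_split (i j : nat) : (i.+1 < j)%N ->
  exists2 m : nat, (i < m < j)%N &
    (#|arcs_within i j| <= #|[set p in A | (p.1 == i :> nat) && (p.2 == j :> nat)]|
                           + (#|arcs_within i m| + #|arcs_within m j|))%N.
Proof.
move=> ij; pose P m := (i < m < j)%N &&
  ((m == i.+1) || [exists p in A, (p.1 == i :> nat) && (p.2 == m :> nat)]).
have P0 : exists m, P m by exists i.+1; rewrite /P eqxx ij ltnS leqnn.
have Pj m : P m -> (m <= j)%N by case/andP=> /andP[_ /ltnW].
case: (ex_maxnP P0 Pj) => m /andP[/andP[im mj] Pm] mmax.
exists m; first by rewrite im.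
apply: leq_trans (leq_trans (leq_card_setU _ _) (leq_add (leqnn _) (leq_card_setU _ _))).
apply/subset_leq_card/subsetP => p; rewrite !inE => /and3P[pA ip pj].
rewrite pA ip pj /= andbT.
have [h|h] := boolP ((p.1 == i :> nat) && (p.2 == j :> nat)) => //=.
have [//|mp] := leqP p.2 m.
have [//|pm] := leqP m p.1.
(* An arc from strictly between [i] and [m] to beyond [m] would cross [{i, m}]; if [m = i.+1], no
   such starting point exists. *)
have pi : p.1 = i :> nat.
  apply/eqP; rewrite eqn_leq ip andbT leqNgt; apply/negP => ip'.
  case/orP: Pm => [/eqP mE|/existsP[q /and3P[qA /eqP q1 /eqP q2]]].
    by move: ip' pm; rewrite mE; lia.
  by have := A_noncrossing qA pA; rewrite q1 q2 ip' pm mp.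
have pj' : (p.2 < j)%N.
  by rewrite ltn_neqAle pj andbT; apply: contra h => ->; rewrite pi eqxx.
(* [p] is an arc at [i] ending strictly between [m] and [j], against the choice of [m]. *)
have := mmax p.2; rewrite leqNgt mp; apply.
rewrite /P pj' (ltn_trans im mp) /=; apply/orP; right.
by apply/existsP; exists p; rewrite pA pi !eqxx.
Qed.

Lemma leq_card_same_ends (i j : nat) :
  (#|[set p in A | (p.1 == i :> nat) && (p.2 == j :> nat)]| <= 1)%N.
Proof.
apply/card_le1_eqP => -[p1 p2] [q1 q2]; rewrite !inE /=.
move=> /and3P[_ /eqP h1 /eqP h2] /and3P[_ /eqP h3 /eqP h4].
by congr pair; apply: val_inj; rewrite /= ?h1 ?h2.
Qed.

(** Splitting at [m] gives, by induction, at most [1 + (m - i - 1) + (j - m - 1) = j - i - 1]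
    arcs. *)
Lemma leq_card_arcs_within (i j : nat) : (i < j)%N ->
  (#|arcs_within i j| <= j - i - 1)%N.
Proof.
have [m] := ubnP (j - i); elim: m i j => // m IHm i j /ltnSE jim ij.
have [ij2|ji] := ltnP i.+1 j.
  have [k /andP[ik kj] /leq_trans-> //] := arcs_within_split ij2.
  have := IHm i k; have := IHm k j; have := leq_card_same_ends i j; lia.
suff -> : arcs_within i j = set0 by rewrite cards0.
by apply/setP => p; rewrite !inE; apply/negP => /and3P[/A_long]; lia.
Qed.

Lemma full_succ (i : nat) : full i i.+1.
Proof. by have := @leq_card_arcs_within i i.+1 (leqnn _); rewrite /full; lia. Qed.

(** Equality in the count forces equality in each of the three summands of the splitting bound. *)
Lemma full_split (i j : nat) : (i.+1 < j)%N -> full i j ->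
  [exists p in A, (p.1 == i :> nat) && (p.2 == j :> nat)] /\
  exists m : nat, [/\ (i < m < j)%N, full i m & full m j].
Proof.
move=> ij /eqP fij; have [m /andP[im mj]] := arcs_within_split ij.
have := leq_card_same_ends i j.
have := leq_card_arcs_within im; have := leq_card_arcs_within mj.
rewrite fij => h1 h2 h3 h4; split; last first.
  by exists m; split; [rewrite im|rewrite /full; lia..].
have : (0 < #|[set p in A | (p.1 == i :> nat) && (p.2 == j :> nat)]|)%N by lia.
by case/card_gt0P => p; rewrite inE => ?; apply/existsP; exists p.
Qed.

(* If 0 sees k and the triangle below {0, k} has its third vertex m < k - 1,
   then {m, k} can be flipped; otherwise 0 sees k - 1 as well. *)
Lemma full_fan_or_flip (k : nat) : (0 < k)%N -> full 0 k ->
  (forall m, (0 < m <= k)%N -> full 0 m) \/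
  exists a b c : nat, [/\ (0 < a)%N, (a < b)%N, (b < c)%N, (c <= k)%N &
    [/\ full 0 a, full a b, full b c, full a c & full 0 c]].
Proof.
elim: k => // k IHk _ fk.
have [k0|k0] := posnP k.
  by left => m; rewrite k0 => h; have -> : m = 1%N by [lia]; apply: full_succ.
have [_ [m [/andP[m0 mk] f0m fmk]]] := @full_split 0%N k.+1 k0 fk.
have [mk1|mk1] := ltnP m.+1 k.+1.
  right; have [_ [b [/andP[mb bk] fmb fbk]]] := full_split mk1 fmk.
  (* The diagonal [{m, k.+1}] has the triangle with apex 0 on one side and the one with apex [b] on
     the other. *)
  by exists m, b, k.+1; split.
have Em : m = k by lia.
rewrite Em in f0m; case: (IHk k0 f0m) => [h|[a [b [c [h1 h2 h3 h4 h5]]]]].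
  left => l /andP[l0]; rewrite leq_eqVlt => /orP[/eqP-> //|lk].
  by apply: h; rewrite l0.
by right; exists a, b, c; split=> //; apply: leqW.
Qed.

End NoncrossingArcs.

Section Fan.
Variable n : nat.
Hypothesis n3 : (3 <= n)%N.

Definition vertex0 : 'I_n := Ordinal (ltn_trans (isT : 0 < 2)%N n3).

(** The bounds on [m] leave out vertex 0 and its two neighbours. *)
Definition fan : {set {set 'I_n}} :=
  [set [set vertex0; m] | m : 'I_n & (1 < m)%N && (m.+1 < n)%N].

Lemma leq_card_fan : (n - 3 <= #|fan|)%N.
Proof.
rewrite card_in_imset; last first.
  move=> x y; rewrite !inE => hx hy /eqP; rewrite set2_eq eqxx /=.
  case/orP=> [/eqP //|/andP[/eqP h]]; move: hy; rewrite -h /=; lia.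
have n1 : (1 < n)%N by lia.
have nm : (n.-1 < n)%N by lia.
have := cardsC [set m : 'I_n | (1 < m)%N && (m.+1 < n)%N].
suff : (#|~: [set m : 'I_n | (1 < m)%N && (m.+1 < n)%N]| <= 3)%N.
  rewrite card_ord; lia.
apply: (@leq_trans #|[:: vertex0; Ordinal n1; Ordinal nm]|); last exact: card_size.
apply/subset_leq_card/subsetP => m; rewrite !inE -!val_eqE /=.
have := ltn_ord m; lia.
Qed.

(** Sides are dropped except the closing side [{0, n-1}]: with it, the whole polygon is the region
    under one arc, to which the count of [full] applies. *)
Definition arcs (G : {set {set 'I_n}}) : {set 'I_n * 'I_n} :=
  [set p : 'I_n * 'I_n | (p.1.+1 < p.2)%N &&
     (([set p.1; p.2] \in G) || ((p.1 == 0%N :> nat) && (p.2 == n.-1 :> nat)))].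

Section Triangulation.
Variable G : {set {set 'I_n}}.
Hypothesis tG : triangulation G.

Lemma arcs_edge p : p \in arcs G -> [set p.1; p.2] \in edges G.
Proof.
rewrite inE in_setU => /andP[_ /orP[->|/andP[/eqP h1 /eqP h2]]]; first exact: orbT.
apply/orP; left; suff -> : [set p.1; p.2] = side p.2 by apply: side_in.
rewrite /side setUC; congr (_ |: [set _]); apply: val_inj.
by rewrite [RHS]val_ordS /= h1 h2; case: ifP; lia.
Qed.

Lemma arcs_long p : p \in arcs G -> (p.1.+1 < p.2)%N.
Proof. by rewrite inE => /andP[]. Qed.

Lemma arcs_noncrossing p q : p \in arcs G -> q \in arcs G ->
  ~~ [&& p.1 < q.1, q.1 < p.2 & p.2 < q.2]%N.
Proof.
move=> /arcs_edge hp /arcs_edge hq; apply: contra (edges_noncrossing tG hp hq).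
by case/and3P=> h1 h2 h3; rewrite crossing_cyclic4 /cyclic4 h1 h2 h3.
Qed.

(** The [n - 3] diagonals and the closing arc make [n - 2], the maximum between [0] and [n-1]. *)
Lemma arcs_full : full (arcs G) 0 n.-1.
Proof.
have nm : (n.-1 < n)%N by lia.
pose p0 := (vertex0, Ordinal nm).
have := @leq_card_arcs_within _ _ arcs_long arcs_noncrossing 0 n.-1.
rewrite /full; suff : (n - 2 <= #|arcs_within (arcs G) 0 n.-1|)%N by lia.
have -> : arcs_within (arcs G) 0 n.-1 = arcs G.
  by apply/setP => p; rewrite !inE; have := ltn_ord p.2; lia.
have p0A : p0 \in arcs G by rewrite inE /= !eqxx orbT andbT; lia.
rewrite (cardsD1 p0) p0A; have /and3P[/forall_inP dG _ /eqP cG] := tG.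
suff : (#|G| <= #|arcs G :\ p0|)%N.
  by rewrite cG add1n -ltnS; apply: leq_trans; lia.
apply: leq_trans (leq_imset_card (fun p : 'I_n * 'I_n => [set p.1; p.2]) _).
apply/subset_leq_card/subsetP => a aG.
have /andP[/cards2P[i [j [ij aE]]] aS] := dG _ aG.
wlog ltij : i j ij aE / (i < j)%N.
  move=> h; have [|ji|E] := ltngtP i j; first exact: h.
    by apply: (h j i) => //; rewrite 1?eq_sym // setUC.
  by case/eqP: ij; apply: val_inj.
apply/imsetP; exists (i, j); rewrite // !inE /= -aE aG /=.
rewrite andbT; apply/andP; split.
  apply: contra aS => /eqP[E1 E2]; apply/imsetP; exists j => //.
  rewrite aE setUC /side; congr (_ |: [set _]); apply: val_inj.
  by rewrite [RHS]val_ordS E1 E2 /=; case: ifP; lia.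
rewrite ltn_neqAle ltij andbT; apply: contra aS => /eqP E; apply/imsetP.
exists i => //; rewrite aE /side; congr (_ |: [set _]); apply: val_inj.
by rewrite [RHS]val_ordS /= E ltn_ord.
Qed.

Lemma full_edge (i j : 'I_n) : (i < j)%N -> full (arcs G) i j ->
  [set i; j] \in edges G.
Proof.
move=> ij f; have [ij2|ji] := ltnP i.+1 j.
  have [/existsP[p /and3P[pA /eqP/val_inj <- /eqP/val_inj <-]] _] :=
    full_split arcs_long arcs_noncrossing ij2 f.
  exact: arcs_edge.
suff -> : [set i; j] = side i by rewrite in_setU side_in.
rewrite /side; congr (_ |: [set _]); apply: val_inj; rewrite [RHS]val_ordS.
by have := ltn_ord j; case: ifP => /=; lia.
Qed.

(** In the quadrilateral [0, a, b, c], exchanging [{a, c}] for [{0, b}] gains a fan diagonal and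
    loses none. *)
Lemma fan_or_flip : G = fan \/
  exists G2 v1 v2 v3 v4, whitehead_move G G2 v1 v2 v3 v4 /\
    (#|fan :\: G2| < #|fan :\: G|)%N.
Proof.
have n0 : (0 < n.-1)%N by lia.
case: (full_fan_or_flip arcs_long arcs_noncrossing n0 arcs_full) => [h|].
  (* Vertex 0 is joined to every other vertex, so [G] contains the fan; having only [n - 3]
     elements, it equals the fan. *)
  left; apply/esym/eqP; rewrite eqEcard.
  have /and3P[_ _ /eqP->] := tG; rewrite leq_card_fan andbT.
  apply/subsetP => a /imsetP[m]; rewrite inE => /andP[m1 mn] ->.
  have m0 : (0 < m <= n.-1)%N by lia.
  have := @full_edge vertex0 m (ltnW m1) (h m m0).
  rewrite in_setU => /orP[|//].
  have v0 : (vertex0 : nat) = 0%N by [].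
  case/imsetP=> i _ /eqP; rewrite /side set2_eq.
  move: (val_ordS i); have := ltn_ord i.
  by case: ifP => in1 _ iS /orP[] /andP[/eqP/(congr1 (@nat_of_ord n)) h1
    /eqP/(congr1 (@nat_of_ord n)) h2]; lia.
case=> a [b [c [a0 ab bc cn [f0a fab fbc fac f0c]]]]; right.
have cltn : (c < n)%N by lia.
have bltn := ltn_trans bc cltn; have altn := ltn_trans ab bltn.
pose va := Ordinal altn; pose vb := Ordinal bltn; pose vc := Ordinal cltn.
have e0a : [set vertex0; va] \in edges G by apply: full_edge.
have eab : [set va; vb] \in edges G by apply: full_edge.
have ebc : [set vb; vc] \in edges G by apply: full_edge.
have eac : [set va; vc] \in edges G by apply: full_edge => //=; lia.
have e0c : [set vertex0; vc] \in edges G by apply: full_edge => //=; lia.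
have cyc : cyclic4 va vb vc vertex0 by rewrite /cyclic4 /= ab bc a0 !orbT.
have cr : crossing [set va; vc] [set vb; vertex0] by rewrite crossing_cyclic4.
have dG : [set va; vc] \in G.
  move: eac; rewrite in_setU => /orP[/side_noncrossing|//].
  by move/(_ [set vb; vertex0]); rewrite cr.
have nG : [set vb; vertex0] \notin G.
  apply: contraL cr => h; apply: (edges_noncrossing tG) => //.
  by rewrite in_setU h orbT.
have nS : [set vb; vertex0] \notin sides n.
  by apply: contraL cr => /side_noncrossing; rewrite crossingC.
exists ([set vb; vertex0] |: (G :\ [set va; vc])), va, vb, vc, vertex0; split.
  apply/and4P; split=> //.
  have -> : G :&: ([set vb; vertex0] |: G :\ [set va; vc]) = G :\ [set va; vc].
    apply/setP => x; rewrite !inE; case: (altP eqP) => [->|/= _].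
      by rewrite (negPf nG) andbF.
    by case: (x \in G); rewrite ?andbF.
  have h x : x \in edges G -> x != [set va; vc] -> x \in edges (G :\ [set va; vc]).
    by rewrite !in_setU in_setD1 => /orP[->//|->] ->; rewrite orbT.
  by rewrite (setUC [set vc] [set vertex0]) !h //; rewrite set2_eq -!val_eqE /=;
    clear -a0 ab bc; lia.
apply: proper_card; apply/properP; split.
  apply/subsetP => x; rewrite !inE => /andP[]; rewrite !negb_or negb_and negbK.
  case/andP=> h1 /orP[/eqP->|-> //].
  by case/imsetP=> m _ /eqP; rewrite set2_eq -!val_eqE /=; clear -a0 ab bc; lia.
exists [set vb; vertex0]; last by rewrite !inE eqxx.
rewrite inE nG /=; apply/imsetP; exists vb; last exact: setUC.
rewrite inE /=; clear -a0 ab bc cn n0; lia.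
Qed.

End Triangulation.

Lemma transformation_fan (G : {set {set 'I_n}}) : triangulation G ->
  exists T, transformation G fan T.
Proof.
have [m] := ubnP #|fan :\: G|; elim: m G => // m IHm G /ltnSE Gm tG.
have [->|[G2 [v1 [v2 [v3 [v4 [W lt]]]]]]] := fan_or_flip tG.
  by exists (@PLVar _); apply: transformation_id.
have tG2 : triangulation G2 by apply: whitehead_triangulation W _ tG; lia.
have [T hT] := IHm G2 (leq_trans lt Gm) tG2.
have [T' hT' _] := transformation_trans
  (transformation_move (transformation_id G) W) hT.
by exists T'.
Qed.

End Fan.

(** * Triangle inequalities *)

Definition between (n : nat) (a b x : 'I_n) : bool :=
  (a < x < b)%N || (b < x < a)%N.

(** Separation form of crossing: the chord [{c, d}] has [a] and [b] on different sides. *)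
Lemma crossing_between (n : nat) (a b c d : 'I_n) :
  a != c -> a != d -> b != c -> b != d ->
  crossing [set a; b] [set c; d] = between c d a (+) between c d b.
Proof.
rewrite crossingE /between -!val_eqE /= !neq_ltn /minn /maxn.
move: (a : nat) (b : nat) (c : nat) (d : nat) => {}a {}b {}c {}d.
case: (ltngtP a c) => // ac _; case: (ltngtP a d) => // ad _.
all: case: (ltngtP b c) => // bc _; case: (ltngtP b d) => // bd _.
all: case: (ltnP a b) => ab; rewrite ?ac ?bc ?ad ?bd /=; lia.
Qed.

(** The vertices [a, b, c, d] cut the boundary into four pieces. For [k] inside the piece from [a]
    to [b] or from [b] to [c], the chord [{d, k}] crosses the corresponding side; in the other two
    pieces [{b, k}] does. *)
Lemma crossing_apex (n : nat) (a b c d k : 'I_n) : cyclic4 a b c d ->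
  ~~ crossing [set d; k] [set a; b] -> ~~ crossing [set d; k] [set b; c] ->
  ~~ crossing [set b; k] [set c; d] -> ~~ crossing [set b; k] [set d; a] ->
  k != b -> k != d -> k = a \/ k = c.
Proof.
move=> cyc h1 h2 h3 h4 kb kd.
have [->|ka] := eqVneq k a; first by left.
have [->|kc] := eqVneq k c; first by right.
move: cyc h1 h2 h3 h4; have [-> //|dab] : cyclic4 a b c d = false \/
  [&& d != a, d != b, d != c, b != a & b != c]%N.
  case E: (cyclic4 a b c d); [right|by left]; move: E; rewrite -!val_eqE /=.
  by cyclic_cases; lia.
case/and5P: dab => da db dc ba bc cyc.
rewrite !crossing_between // 1?eq_sym //.
move=> h1 h2 h3 h4; exfalso.
move: cyc kb kd ka kc h1 h2 h3 h4; rewrite /between -!val_eqE /=; clear.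
rewrite /cyclic4.
move: (a : nat) (b : nat) (c : nat) (d : nat) (k : nat) => {}a {}b {}c {}d {}k.
rewrite !neq_ltn.
case: (ltngtP k a) => // ka; case: (ltngtP k b) => // kb;
case: (ltngtP k c) => // kc; case: (ltngtP k d) => // kd.
all: rewrite /= ?andbT ?andbF ?orbF ?orbT /=.
all: by cyclic_cases; lia.
Qed.

Lemma triangleE (n : nat) (G : {set {set 'I_n}}) (i j k : 'I_n) :
  triangle G i j k = [&& i != j, i != k, j != k, [set i; j] \in edges G,
                         [set j; k] \in edges G & [set i; k] \in edges G].
Proof. by rewrite /triangle /= in_cons mem_seq1 negb_or andbT -!andbA mem_seq1. Qed.

Lemma triangle_perm (n : nat) (G : {set {set 'I_n}}) (i j k : 'I_n) :
  triangle G i j k -> triangle G j i k /\ triangle G i k j.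
Proof.
rewrite triangleE => /and5P[ij ik jk h1 /andP[h2 h3]].
by split; rewrite triangleE ?(eq_sym j i) ?(eq_sym k j) ij ik jk ?(setUC [set j] [set i])
  ?(setUC [set k] [set j]) h1 h2 h3.
Qed.

Lemma whitehead_quad_edges (n : nat) (G1 G2 : {set {set 'I_n}}) v1 v2 v3 v4 :
  whitehead_move G1 G2 v1 v2 v3 v4 ->
  [/\ [set v1; v2] \in edges G1, [set v2; v3] \in edges G1,
      [set v3; v4] \in edges G1 & [set v4; v1] \in edges G1].
Proof.
move=> /whitehead_quad q; split.
- by case: (q [set v1; v2]) => //; rewrite !inE eqxx.
- by case: (q [set v2; v3]) => //; rewrite !inE eqxx ?orbT.
- by case: (q [set v3; v4]) => //; rewrite !inE eqxx ?orbT.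
- by case: (q [set v4; v1]) => //; rewrite !inE eqxx ?orbT.
Qed.

Section WhiteheadTriangles.
Variables (n : nat) (G1 G2 : {set {set 'I_n}}) (v1 v2 v3 v4 : 'I_n).
Hypotheses (tG : triangulation G1) (W : whitehead_move G1 G2 v1 v2 v3 v4).

Lemma whitehead_triangle_apex (k : 'I_n) :
  triangle G2 v2 v4 k -> k = v1 \/ k = v3.
Proof.
have n1 : (1 < n)%N.
  have [/eqP/val_eqP/= + _ _ _] := whitehead_neq W.
  by have := ltn_ord v1; have := ltn_ord v2; lia.
have tG2 := whitehead_triangulation W n1 tG.
rewrite triangleE => /and5P[_ k2 k4 _ /andP[h4 h2]].
have [e23 e34 e41 e12] := whitehead_quad_edges (whitehead_sym W tG).
have kv2 : k != v2 by rewrite eq_sym.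
have kv4 : k != v4 by rewrite eq_sym.
by apply: (crossing_apex (whitehead_cyclic W)) => //;
  apply: (edges_noncrossing tG2).
Qed.

Lemma whitehead_old_triangles : triangle G1 v1 v2 v3 /\ triangle G1 v3 v4 v1.
Proof.
have [n12 n13 n14 [n23 n24 n34]] := whitehead_neq W.
have [e12 e23 e34 e41] := whitehead_quad_edges W.
have e13 : [set v1; v3] \in edges G1 by rewrite in_setU (whitehead_old W) orbT.
rewrite !triangleE n12 n13 n23 n34 (eq_sym v3 v1) n13 (eq_sym v4 v1) n14.
by rewrite (setUC [set v3] [set v1]) e12 e23 e34 e41 e13.
Qed.

Lemma whitehead_map_new : whitehead_map v1 v2 v3 v4 [set v2; v4] =
  let u1 := PLVar [set v1; v2] in
  let u2 := PLVar [set v2; v3] in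
  let u3 := PLVar [set v3; v4] in
  let u4 := PLVar [set v4; v1] in
  PLAdd (PLSub (PLVar [set v1; v3]) (PLMin (PLAdd u1 u2) (PLAdd u3 u4)))
        (PLMin (PLAdd u1 u4) (PLAdd u2 u3)).
Proof. by rewrite /whitehead_map eqxx. Qed.

Lemma whitehead_map_old (a : {set 'I_n}) : a != [set v2; v4] ->
  whitehead_map v1 v2 v3 v4 a = PLVar a.
Proof. by rewrite /whitehead_map => /negPf->. Qed.

Lemma whitehead_map_quad :
  [/\ whitehead_map v1 v2 v3 v4 [set v1; v2] = PLVar [set v1; v2],
      whitehead_map v1 v2 v3 v4 [set v2; v3] = PLVar [set v2; v3],
      whitehead_map v1 v2 v3 v4 [set v3; v4] = PLVar [set v3; v4] &
      whitehead_map v1 v2 v3 v4 [set v4; v1] = PLVar [set v4; v1]].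
Proof.
by split; apply: whitehead_map_old;
  match goal with |- is_true (?a != _) =>
    by case: (whitehead_quad W (a := a)) => //; rewrite !inE eqxx ?orbT end.
Qed.

End WhiteheadTriangles.

(** As [triangle] is invariant under permutations, this single form includes all three inequalities
    of a triangle, hence also the absolute value bound. *)
Definition triangle_inequalities (n : nat) (R : realFieldType)
    (G : {set {set 'I_n}}) (u : {set 'I_n} -> R) : Prop :=
  forall i j k, triangle G i j k -> u [set i; k] <= u [set i; j] + u [set j; k].

Lemma in_polytopeP (n : nat) (R : realFieldType) (r : R) G I
    (x : {ffun @cvar n G -> R}) :
  in_polytope r I x <-> triangle_inequalities G (u_edge r I x).
Proof.
split=> h; first by move=> i j k tri; have /andP[] := h i j k tri.
move=> /= i j k tri.
have [t1 t2] := triangle_perm tri; have [_ t3] := triangle_perm t1.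
rewrite (h _ _ _ tri) andbT ler_norml.
have := h _ _ _ t2; have := h _ _ _ t1; rewrite (setUC [set k]) (setUC [set j] [set i]).
by move=> h1 h2; apply/andP; split; lra.
Qed.

(** Only the two triangles at the new diagonal are affected. Their six inequalities follow from the
    six of the old triangles once it is fixed which sums attain the two minima. *)
Lemma whitehead_triangle_inequalities (n : nat) (G1 G2 : {set {set 'I_n}}) v1 v2 v3 v4
    (R : realFieldType) (u : {set 'I_n} -> R) :
  triangulation G1 -> whitehead_move G1 G2 v1 v2 v3 v4 ->
  triangle_inequalities G1 u ->
  triangle_inequalities G2 (fun a => pl_eval u (whitehead_map v1 v2 v3 v4 a)).
Proof.
move=> tG W hu; set w := fun a => _.
have [m12 m23 m34 m41] := whitehead_map_quad W.
have wnew : w [set v2; v4] = u [set v1; v3] -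
    Num.min (u [set v1; v2] + u [set v2; v3]) (u [set v3; v4] + u [set v4; v1]) +
    Num.min (u [set v1; v2] + u [set v4; v1]) (u [set v2; v3] + u [set v3; v4]).
  by rewrite /w whitehead_map_new.
have [t1 t3] := whitehead_old_triangles W.
have [t1a t1b] := triangle_perm t1; have [t3a t3b] := triangle_perm t3.
have := (hu _ _ _ t1, hu _ _ _ t1a, hu _ _ _ t1b, hu _ _ _ t3, hu _ _ _ t3a, hu _ _ _ t3b).
rewrite (setUC [set v3] [set v1]) (setUC [set v2] [set v1]) (setUC [set v3] [set v2]).
rewrite (setUC [set v4] [set v3]) (setUC [set v1] [set v4]).
move=> [[[[[h1 h2] h3] h4] h5] h6].
have w12 : w [set v1; v2] = u [set v1; v2] by rewrite /w m12.
have w23 : w [set v2; v3] = u [set v2; v3] by rewrite /w m23.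
have w34 : w [set v3; v4] = u [set v3; v4] by rewrite /w m34.
have w41 : w [set v4; v1] = u [set v4; v1] by rewrite /w m41.
have new k : triangle G2 v2 v4 k ->
    [/\ w [set v2; v4] <= w [set v2; k] + w [set v4; k],
        w [set v2; k] <= w [set v2; v4] + w [set v4; k] &
        w [set v4; k] <= w [set v2; v4] + w [set v2; k]].
  case/(whitehead_triangle_apex tG W) => ->.
    rewrite (setUC [set v2] [set v1]) w12 w41 wnew; move: h1 h2 h3 h4 h5 h6.
    by rewrite /Num.min; case: ltP => c1; case: ltP => c2 *; split; lra.
  rewrite (setUC [set v4] [set v3]) w23 w34 wnew; move: h1 h2 h3 h4 h5 h6.
  by rewrite /Num.min; case: ltP => c1; case: ltP => c2 *; split; lra.
have new' i j k : triangle G2 i j k -> [set i; j] = [set v2; v4] ->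
    [/\ w [set i; j] <= w [set i; k] + w [set j; k],
        w [set i; k] <= w [set i; j] + w [set j; k] &
        w [set j; k] <= w [set i; j] + w [set i; k]].
  move=> tri /eqP; rewrite set2_eq => /orP[]/andP[/eqP ? /eqP ?]; subst i j.
    exact: new.
  have [/new[k1 k2 k3] _] := triangle_perm tri.
  by rewrite (setUC [set v4]); split=> //; lra.
move=> i j k tri; have [tri1 tri2] := triangle_perm tri.
have [/(new' _ _ _ tri)[] //|nij] := [set i; j] =P [set v2; v4].
have [/(new' _ _ _ tri2)[h _ _]|nik] := [set i; k] =P [set v2; v4].
  by rewrite (setUC [set j]).
have [tri3 tri4] := triangle_perm tri1.
have [/(new' _ _ _ tri4)[_ _]|njk] := [set j; k] =P [set v2; v4].
  by rewrite !(setUC [set k]) (setUC [set j] [set i]) addrC.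
(* No edge of the triangle is the new diagonal, so it is a triangle of [G1] with unchanged
   lengths. *)
rewrite /w !whitehead_map_old; try exact/eqP.
apply: hu; move: tri; rewrite /triangle !(whitehead_edge W).
by move/eqP/negPf: nij => ->; move/eqP/negPf: nik => ->;
   move/eqP/negPf: njk => -> /= /and4P[-> /andP[_ ->] /andP[_ ->] /andP[_ ->]].
Qed.

Lemma pl_eval_subst (V W : Type) (R : realFieldType) (u : W -> R)
    (s : V -> plexpr W) (e : plexpr V) :
  pl_eval u (pl_subst s e) = pl_eval (fun v => pl_eval u (s v)) e.
Proof. by elim: e => //= e1 -> e2 ->. Qed.

Lemma lift_eval_subst (V W : Type) (K : fieldType) (y : W -> K)
    (s : V -> plexpr W) (e : plexpr V) :
  lift_eval y (pl_subst s e) = lift_eval (fun v => lift_eval y (s v)) e.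
Proof. by elim: e => //= e1 -> e2 ->. Qed.

Lemma transformation_triangle_inequalities (n : nat) (G' G : {set {set 'I_n}}) T
    (R : realFieldType) (u : {set 'I_n} -> R) :
  (1 < n)%N -> triangulation G' -> transformation G' G T ->
  triangle_inequalities G' u ->
  triangle_inequalities G (fun a => pl_eval u (T a)).
Proof.
move=> n1 tG' hT hu; elim: hT => [//|G1 G2 T1 v1 v2 v3 v4 h1 IH W] i j k tri.
have tG1 := transformation_triangulation n1 tG' h1.
by rewrite !pl_eval_subst; apply: (whitehead_triangle_inequalities tG1 W IH).
Qed.

(** * Inverses and specialization *)

Lemma eq_pl_eval (V : Type) (R : realFieldType) (u w : V -> R) (e : plexpr V) :
  u =1 w -> pl_eval u e = pl_eval w e.
Proof. by move=> uw; elim: e => [v|||] //= e1 -> e2 ->. Qed.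

Lemma eq_lift_eval (V : Type) (K : fieldType) (u w : V -> K) (e : plexpr V) :
  u =1 w -> lift_eval u e = lift_eval w e.
Proof. by move=> uw; elim: e => [v|||] //= e1 -> e2 ->. Qed.

Lemma whitehead_pl_eval (n : nat) (G1 G2 : {set {set 'I_n}}) v1 v2 v3 v4
    (R : realFieldType) (u w : {set 'I_n} -> R) :
  whitehead_move G1 G2 v1 v2 v3 v4 -> {in edges G1, u =1 w} ->
  {in edges G2, forall a, pl_eval u (whitehead_map v1 v2 v3 v4 a) =
                         pl_eval w (whitehead_map v1 v2 v3 v4 a)}.
Proof.
move=> W uw a; have [e12 e23 e34 e41] := whitehead_quad_edges W.
have e13 : [set v1; v3] \in edges G1 by rewrite in_setU (whitehead_old W) orbT.
rewrite (whitehead_edge W) /whitehead_map.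
by case: eqP => /= [_ _|_ /andP[_ /uw]] //; rewrite !uw.
Qed.

(** The expressions for the edges of [G] read values at edges of [G'] only, so identities known just
    on edges may be substituted into them. *)
Lemma transformation_pl_eval (n : nat) (G' G : {set {set 'I_n}}) T
    (R : realFieldType) (u w : {set 'I_n} -> R) :
  transformation G' G T -> {in edges G', u =1 w} ->
  {in edges G, forall a, pl_eval u (T a) = pl_eval w (T a)}.
Proof.
move=> hT uw; elim: hT => [//|G1 G2 T1 v1 v2 v3 v4 _ IH W] a aG.
by rewrite !pl_eval_subst; apply: (whitehead_pl_eval W IH).
Qed.

(** Reversing a move twice returns it with its labels rotated by two; the formula does not notice
    this. *)
Lemma whitehead_map_rot2_pl (n : nat) (v1 v2 v3 v4 : 'I_n) a
    (R : realFieldType) (u : {set 'I_n} -> R) :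
  pl_eval u (whitehead_map v3 v4 v1 v2 a) =
  pl_eval u (whitehead_map v1 v2 v3 v4 a).
Proof.
rewrite /whitehead_map (setUC [set v4] [set v2]); case: ifP => //= _.
rewrite (setUC [set v3] [set v1]) [Num.min (u [set v3; v4] + u [set v4; v1]) _]minC.
rewrite [u [set v3; v4] + u [set v2; v3]]addrC [u [set v4; v1] + u [set v1; v2]]addrC.
by rewrite [Num.min (u [set v2; v3] + _) _]minC.
Qed.

Lemma whitehead_lift_eval (n : nat) (G1 G2 : {set {set 'I_n}}) v1 v2 v3 v4
    (K : fieldType) (u w : {set 'I_n} -> K) :
  whitehead_move G1 G2 v1 v2 v3 v4 -> {in edges G1, u =1 w} ->
  {in edges G2, forall a, lift_eval u (whitehead_map v1 v2 v3 v4 a) =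
                         lift_eval w (whitehead_map v1 v2 v3 v4 a)}.
Proof.
move=> W uw a; have [e12 e23 e34 e41] := whitehead_quad_edges W.
have e13 : [set v1; v3] \in edges G1 by rewrite in_setU (whitehead_old W) orbT.
rewrite (whitehead_edge W) /whitehead_map.
by case: eqP => /= [_ _|_ /andP[_ /uw]] //; rewrite !uw.
Qed.

Lemma transformation_lift_eval (n : nat) (G' G : {set {set 'I_n}}) T
    (K : fieldType) (u w : {set 'I_n} -> K) :
  transformation G' G T -> {in edges G', u =1 w} ->
  {in edges G, forall a, lift_eval u (T a) = lift_eval w (T a)}.
Proof.
move=> hT uw; elim: hT => [//|G1 G2 T1 v1 v2 v3 v4 _ IH W] a aG.
by rewrite !lift_eval_subst; apply: (whitehead_lift_eval W IH).
Qed.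

Lemma whitehead_map_rot2_lift (n : nat) (v1 v2 v3 v4 : 'I_n) a
    (K : fieldType) (u : {set 'I_n} -> K) :
  lift_eval u (whitehead_map v3 v4 v1 v2 a) =
  lift_eval u (whitehead_map v1 v2 v3 v4 a).
Proof.
rewrite /whitehead_map (setUC [set v4] [set v2]); case: ifP => //= _.
by rewrite (setUC [set v3] [set v1]); congr (_ / _ * _); ring.
Qed.

Lemma whitehead_side (n : nat) (G1 G2 : {set {set 'I_n}}) v1 v2 v3 v4 a :
  whitehead_move G1 G2 v1 v2 v3 v4 -> a \in sides n ->
  whitehead_map v1 v2 v3 v4 a = PLVar a.
Proof.
move=> W sa; rewrite whitehead_map_old //.
by apply: contraTneq sa => ->; apply: whitehead_new_side W.
Qed.

(** Sides are never flipped; hence the perimeter and the product of the side variables are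
    preserved. *)
Lemma transformation_side (n : nat) (G' G : {set {set 'I_n}}) T a :
  transformation G' G T -> a \in sides n -> T a = PLVar a.
Proof.
move=> hT sa; elim: hT => [//|G1 G2 T1 v1 v2 v3 v4 _ IH W].
by rewrite (whitehead_side W sa) /= IH.
Qed.

(** Rotating the labels by one exchanges the two minima, so the reverse move adds what was
    subtracted and subtracts what was added. *)
Lemma whitehead_pl_inverse (n : nat) (G1 G2 : {set {set 'I_n}}) v1 v2 v3 v4
    (R : realFieldType) (u : {set 'I_n} -> R) :
  triangulation G1 -> whitehead_move G1 G2 v1 v2 v3 v4 ->
  {in edges G1, forall a,
    pl_eval (fun b => pl_eval u (whitehead_map v1 v2 v3 v4 b))
      (whitehead_map v2 v3 v4 v1 a) = u a}.
Proof.
move=> tG W a aG; have [m12 m23 m34 m41] := whitehead_map_quad W.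
have a_new : a != [set v2; v4].
  by apply: contraTneq aG => ->; apply: whitehead_new_old W tG.
have [->|a_old] := eqVneq a [set v1; v3].
  rewrite {2}/whitehead_map (setUC [set v3]) eqxx /= m12 m23 m34 m41.
  rewrite whitehead_map_new /= [u [set v2; v3] + u [set v1; v2]]addrC.
  by rewrite [u [set v4; v1] + _]addrC [Num.min (_ + u [set v3; v4]) _]minC; ring.
by rewrite whitehead_map_old ?(setUC [set v3]) //= whitehead_map_old.
Qed.

(** [S x c] reads: [x] is defined at a chosen point and has the value [c] there. It is a relation
    because evaluating rational functions is partial; a nonzero value certifies that [x] is
    nonzero. *)
Record specialization (K L : fieldType) (S : K -> L -> Prop) : Prop :=
  Specialization {
    spec1 : S 1 1;
    specD : forall x y c d, S x c -> S y d -> S (x + y) (c + d);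
    specM : forall x y c d, S x c -> S y d -> S (x * y) (c * d);
    specV : forall x c, c != 0 -> S x c -> S x^-1 c^-1;
    spec_neq0 : forall x c, c != 0 -> S x c -> x != 0 }.

(* A point of the torus that every Whitehead map respects and at which none of
   them divides by zero. *)
Record whitehead_point (n : nat) (L : fieldType) (y : {set 'I_n} -> L) : Prop :=
  WhiteheadPoint {
    wpoint_neq0 : forall a : {set 'I_n}, #|a| = 2 -> y a != 0;
    wpoint_den_neq0 : forall a b c d, cyclic4 a b c d ->
      y [set a; b] * y [set b; c] + y [set c; d] * y [set d; a] != 0;
    wpoint_exchange : forall a b c d, cyclic4 a b c d ->
      y [set a; c] * (y [set a; b] * y [set d; a] + y [set b; c] * y [set c; d]) =
      y [set b; d] * (y [set a; b] * y [set b; c] + y [set c; d] * y [set d; a]) }.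

Lemma cyclic4_rot (n : nat) (a b c d : 'I_n) : cyclic4 a b c d -> cyclic4 b c d a.
Proof.
rewrite /cyclic4 => /orP[|/orP[|/orP[|/orP[|/orP[|/orP[|/orP[]]]]]]] /andP[h1 h2].
all: by rewrite h1 h2 ?orbT.
Qed.

Section Specialized.
Variables (n : nat) (L : fieldType) (y : {set 'I_n} -> L).
Hypotheses (n1 : (1 < n)%N) (wy : whitehead_point y).
Variables (K : fieldType) (S : K -> L -> Prop).
Hypothesis sS : specialization S.

Definition specializes (G : {set {set 'I_n}}) (Y : {set 'I_n} -> K) : Prop :=
  {in edges G, forall a, S (Y a) (y a)}.

Lemma specializes_neq0 G Y : triangulation G -> specializes G Y ->
  {in edges G, forall a, Y a != 0}.
Proof.
move=> tG sY a aG; apply: (spec_neq0 sS) (sY a aG).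
exact: (wpoint_neq0 wy) (card_edge n1 tG aG).
Qed.

Section Move.
Variables (G1 G2 : {set {set 'I_n}}) (v1 v2 v3 v4 : 'I_n).
Variable (Y : {set 'I_n} -> K).
Hypotheses (tG : triangulation G1) (W : whitehead_move G1 G2 v1 v2 v3 v4).
Hypothesis sY : specializes G1 Y.

Lemma whitehead_den_spec :
  S (Y [set v1; v2] * Y [set v2; v3] + Y [set v3; v4] * Y [set v4; v1])
    (y [set v1; v2] * y [set v2; v3] + y [set v3; v4] * y [set v4; v1]) /\
  S (Y [set v1; v2] * Y [set v4; v1] + Y [set v2; v3] * Y [set v3; v4])
    (y [set v1; v2] * y [set v4; v1] + y [set v2; v3] * y [set v3; v4]).
Proof.
have [e12 e23 e34 e41] := whitehead_quad_edges W.
by split; apply: (specD sS); apply: (specM sS); apply: sY.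
Qed.

Lemma whitehead_den_neq0 :
  Y [set v1; v2] * Y [set v2; v3] + Y [set v3; v4] * Y [set v4; v1] != 0 /\
  Y [set v1; v2] * Y [set v4; v1] + Y [set v2; v3] * Y [set v3; v4] != 0.
Proof.
have [h1 h2] := whitehead_den_spec; have cyc := whitehead_cyclic W.
split; first exact: (spec_neq0 sS) (wpoint_den_neq0 wy cyc) h1.
(* The second sum is the first one for the quadruple rotated by one. *)
apply: (spec_neq0 sS) h2; rewrite addrC mulrC [X in _ + X]mulrC.
have := wpoint_den_neq0 wy (cyclic4_rot cyc).
by rewrite [X in X + _]mulrC.
Qed.

(** By the exchange relation, the lifted move gives the new diagonal exactly the value prescribed by
    [y], so one point serves all triangulations. *)
Lemma whitehead_specializes :
  specializes G2 (fun a => lift_eval Y (whitehead_map v1 v2 v3 v4 a)).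
Proof.
move=> a; rewrite (whitehead_edge W); have [->|na] := eqVneq a [set v2; v4].
  rewrite whitehead_map_new /= => _.
  have [h1 h2] := whitehead_den_spec; have cyc := whitehead_cyclic W.
  have A0 := wpoint_den_neq0 wy cyc.
  have -> : y [set v2; v4] = y [set v1; v3] /
    (y [set v1; v2] * y [set v2; v3] + y [set v3; v4] * y [set v4; v1]) *
    (y [set v1; v2] * y [set v4; v1] + y [set v2; v3] * y [set v3; v4]).
    by rewrite mulrAC (wpoint_exchange wy cyc) mulfK.
  do 2!apply: (specM sS) => //; last exact: (specV sS).
  by apply: sY; rewrite in_setU (whitehead_old W) orbT.
by move=> /andP[_ aG]; rewrite whitehead_map_old //=; apply: sY.
Qed.

Lemma whitehead_lift_inverse : {in edges G1, forall a,
    lift_eval (fun b => lift_eval Y (whitehead_map v1 v2 v3 v4 b))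
      (whitehead_map v2 v3 v4 v1 a) = Y a}.
Proof.
move=> a aG; have [m12 m23 m34 m41] := whitehead_map_quad W.
have a_new : a != [set v2; v4].
  by apply: contraTneq aG => ->; apply: whitehead_new_old W tG.
have [->|a_old] := eqVneq a [set v1; v3].
  have [A0 B0] := whitehead_den_neq0.
  rewrite {2}/whitehead_map (setUC [set v3]) eqxx /= m12 m23 m34 m41.
  rewrite whitehead_map_new /=; field.
  by rewrite A0 addrC [_ * Y [set v1; v2]]mulrC B0.
by rewrite whitehead_map_old ?(setUC [set v3]) //= whitehead_map_old.
Qed.

End Move.

Lemma transformation_specializes G' G T Y :
  triangulation G' -> transformation G' G T -> specializes G' Y ->
  specializes G (fun a => lift_eval Y (T a)).
Proof.
move=> tG' hT sY; elim: hT => [//|G1 G2 T1 v1 v2 v3 v4 h1 IH W] a aG.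
by rewrite lift_eval_subst; apply: (whitehead_specializes W IH).
Qed.

(** The only division in a move is by the sum replacing the subtracted minimum, which is nonzero
    because its specialization is. *)
Lemma transformation_lift_defined G' G T Y :
  triangulation G' -> transformation G' G T -> specializes G' Y ->
  {in edges G, forall a, lift_defined Y (T a)}.
Proof.
move=> tG' hT sY; elim: hT => [//|G1 G2 T1 v1 v2 v3 v4 h1 IH W] a.
have s1 := transformation_specializes tG' h1 sY.
have [e12 e23 e34 e41] := whitehead_quad_edges W.
have e13 : [set v1; v3] \in edges G1 by rewrite in_setU (whitehead_old W) orbT.
rewrite (whitehead_edge W) /whitehead_map.
case: eqP => /= [_ _|_ /andP[_ /IH]] //; rewrite !IH //=.
by have [-> _] := whitehead_den_neq0 W s1.
Qed.

End Specialized.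

(* T' undoes T, for the piecewise-linear maps everywhere and for their lifts
   wherever a whitehead_point guarantees that nothing is divided by zero. *)
Definition left_inverse (n : nat) (G' : {set {set 'I_n}})
    (T T' : {set 'I_n} -> plexpr {set 'I_n}) : Prop :=
  (forall (R : realFieldType) (u : {set 'I_n} -> R), {in edges G', forall a,
     pl_eval (fun b => pl_eval u (T b)) (T' a) = u a}) /\
  (forall (L K : fieldType) (y : {set 'I_n} -> L) (S : K -> L -> Prop) Y,
     whitehead_point y -> specialization S -> specializes y S G' Y ->
     {in edges G', forall a,
       lift_eval (fun b => lift_eval Y (T b)) (T' a) = Y a}).

Lemma transformation_inverse (n : nat) (G' G : {set {set 'I_n}}) T :
  (1 < n)%N -> triangulation G' -> transformation G' G T ->
  exists T', [/\ transformation G G' T', left_inverse G' T T' & left_inverse G T' T].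
Proof.
move=> n1 tG'; elim=> [|G1 G2 T1 v1 v2 v3 v4 h1 [T' [h1' [iPL iL] [iPL' iL']]] W].
  by exists (@PLVar _); split=> //; apply: transformation_id.
have tG1 := transformation_triangulation n1 tG' h1.
have tG2 := whitehead_triangulation W n1 tG1.
have W' := whitehead_sym W tG1.
(* The last move is undone first, then the inverse of the earlier path is applied. *)
have [T'' hT'' ET''] :=
  transformation_trans (transformation_move (transformation_id G2) W') h1'.
exists T''; split=> //; split.
- move=> R u a aG; rewrite ET'' pl_eval_subst -[RHS](iPL R) //.
  apply: (transformation_pl_eval h1') => // b bG; rewrite pl_subst_var.
  rewrite -[RHS](whitehead_pl_inverse (fun b => pl_eval u (T1 b)) tG1 W) //.
  by apply: eq_pl_eval => c; apply: pl_eval_subst.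
- move=> L K y S Y wy sS sY a aG; rewrite ET'' lift_eval_subst.
  rewrite -[RHS](iL _ _ _ _ _ wy sS sY) //.
  apply: (transformation_lift_eval h1') => // b bG; rewrite pl_subst_var.
  have s1 := transformation_specializes wy sS tG' h1 sY.
  rewrite -[RHS](whitehead_lift_inverse wy sS tG1 W s1) //.
  by apply: eq_lift_eval => c; apply: lift_eval_subst.
- move=> R u a aG; rewrite pl_eval_subst.
  pose w b := pl_eval u (whitehead_map v2 v3 v4 v1 b).
  rewrite -[RHS](whitehead_pl_inverse u tG2 W') // [RHS]whitehead_map_rot2_pl.
  apply: (whitehead_pl_eval W) => // b bG; rewrite -[RHS](iPL' _ w) //.
  apply: eq_pl_eval => c; rewrite ET'' pl_eval_subst.
  by apply: eq_pl_eval => e; rewrite pl_subst_var.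
- move=> L K y S Y wy sS sY a aG; rewrite lift_eval_subst.
  pose w b := lift_eval Y (whitehead_map v2 v3 v4 v1 b).
  have s1 : specializes y S G1 w by apply: (whitehead_specializes wy sS W').
  rewrite -[RHS](whitehead_lift_inverse wy sS tG2 W' sY) // [RHS]whitehead_map_rot2_lift.
  apply: (whitehead_lift_eval W) => // b bG; rewrite -[RHS](iL' _ _ _ _ w wy sS) //.
  apply: eq_lift_eval => c; rewrite ET'' lift_eval_subst.
  by apply: eq_lift_eval => e; rewrite pl_subst_var.
Qed.

(** * The potential as a sum over corners of triangles *)

(** Unordered vertex sets replace sorted triples, so that a flip need not know how [v1, ..., v4] are
    ordered. *)
Definition triangle_set (n : nat) (G : {set {set 'I_n}}) (t : {set 'I_n}) : bool :=
  (#|t| == 3%N) &&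
  [forall x in t, forall y in t, (x != y) ==> ([set x; y] \in edges G)].

(** The three terms of the potential on one triangle, indexed by the corner opposite to the edge in
    the denominator. *)
Definition corner_sum (n : nat) (K : fieldType) (Y : {set 'I_n} -> K)
    (t : {set 'I_n}) : K :=
  \sum_(v in t) (\prod_(w in t :\ v) Y [set v; w]) / Y (t :\ v).

Lemma set3D (T : finType) (a b c : T) : a != b -> a != c ->
  [set a; b; c] :\ a = [set b; c].
Proof.
move=> ab ac; rewrite -setUA setU1K // !inE negb_or ab; exact: ac.
Qed.

Lemma set3_rot (T : finType) (a b c : T) : [set a; b; c] = [set b; c; a].
Proof. by rewrite -setUA setUC. Qed.

Lemma corner_sum_set3 (n : nat) (K : fieldType) (Y : {set 'I_n} -> K) a b c :
  a != b -> a != c -> b != c ->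
  corner_sum Y [set a; b; c] =
    Y [set a; b] * Y [set a; c] / Y [set b; c] +
    Y [set b; c] * Y [set a; b] / Y [set a; c] +
    Y [set a; c] * Y [set b; c] / Y [set a; b].
Proof.
move=> ab ac bc; rewrite /corner_sum.
have ba : b != a by rewrite eq_sym.
have ca : c != a by rewrite eq_sym.
have cb : c != b by rewrite eq_sym.
have prod2 (x y z : 'I_n) : y != z ->
    \prod_(w in [set y; z]) Y [set x; w] = Y [set x; y] * Y [set x; z].
  by move=> yz; rewrite big_setU1 ?inE //= big_set1.
rewrite -setUA big_setU1 ?inE ?negb_or ?ab //= big_setU1 ?inE //= big_set1 setUA.
rewrite set3D // [in X in _ + (X + _)]set3_rot [in X in _ + (_ + X)]set3_rot.
rewrite [in X in _ + (_ + X)]set3_rot !set3D // !prod2 // addrA.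
by rewrite (setUC [set b] [set a]) !(setUC [set c]).
Qed.

Lemma triangle_set3 (n : nat) (G : {set {set 'I_n}}) a b c :
  a != b -> a != c -> b != c ->
  triangle_set G [set a; b; c] = triangle G a b c.
Proof.
move=> ab ac bc; rewrite triangleE ab ac bc /=.
rewrite /triangle_set -setUA cardsU1 cards2 in_set2 negb_or ab ac bc /=.
apply/forall_inP/and3P => [h|[e1 e2 e3] x].
  have h' x y : x \in a |: [set b; c] -> y \in a |: [set b; c] -> x != y ->
      [set x; y] \in edges G.
    by move=> xt yt; have /forall_inP/(_ y yt)/implyP := h x xt.
  by split; apply: h'; rewrite // !inE eqxx ?orbT.
rewrite in_setU1 in_set2 => /or3P[]/eqP->; apply/forall_inP => y;
rewrite in_setU1 in_set2 => /or3P[]/eqP->;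
by rewrite ?eqxx ?(setUC [set b] [set a]) ?(setUC [set c]) ?e1 ?e2 ?e3 ?implybT.
Qed.

Lemma set3_sorted (n : nat) (t : {set 'I_n}) : #|t| = 3%N ->
  exists i j k : 'I_n, [/\ (i < j)%N, (j < k)%N & t = [set i; j; k]].
Proof.
move=> t3; have [x xt] : exists x, x \in t by apply/card_gt0P; rewrite t3.
pose i := [arg min_(i < x in t) (i : nat)].
pose k := [arg max_(i > x in t) (i : nat)].
have [it imin] : i \in t /\ forall j, j \in t -> (i <= j)%N.
  by rewrite /i; case: arg_minnP.
have [kt kmax] : k \in t /\ forall j, j \in t -> (j <= k)%N.
  by rewrite /k; case: arg_maxnP.
have [j] : exists j, j \in t :\ i :\ k.
  apply/card_gt0P; have := cardsD1 i t; have := cardsD1 k (t :\ i).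
  by rewrite t3 it; case: (k \in _); lia.
rewrite !inE => /and3P[jk ji jt].
have ij : (i < j)%N by rewrite ltn_neqAle eq_sym ji imin.
have jk' : (j < k)%N by rewrite ltn_neqAle jk kmax.
exists i, j, k; split=> //; apply/esym/eqP; rewrite eqEcard t3.
apply/andP; split.
  by apply/subsetP => y; rewrite !inE -orbA => /or3P[]/eqP->.
rewrite setUC cardsU1 cards2 !inE -!val_eqE /=; lia.
Qed.

Lemma set3_sorted_inj (n : nat) (i j k a b c : 'I_n) :
  (i < j)%N -> (j < k)%N -> (a < b)%N -> (b < c)%N ->
  [set i; j; k] = [set a; b; c] -> [/\ i = a, j = b & k = c].
Proof.
move=> ij jk ab bc /setP E.
have := (E i, E j, E k); rewrite !inE !eqxx ?orbT /=.
have := (E a, E b, E c); rewrite !inE !eqxx ?orbT /= -!val_eqE /=.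
move=> [[h1 h2] h3] [[h4 h5] h6].
have [ia jb kc] : [/\ i = a :> nat, j = b :> nat & k = c :> nat].
  by move: ij jk ab bc h1 h2 h3 h4 h5 h6; clear; split; lia.
by split; apply: val_inj.
Qed.

(** A three-element set is sorted in exactly one way, so sorted triples can be reindexed by their
    vertex sets. *)
Lemma potential_corner_sum (n : nat) (K : fieldType) (Q : K) (G : {set {set 'I_n}}) I
    (y : {ffun cvar G -> K}) :
  potential Q I y = \sum_(t | triangle_set G t) corner_sum (y_edge Q I y) t.
Proof.
rewrite /potential; set Y := y_edge Q I y.
under eq_bigr => i _ do rewrite pair_big_dep.
rewrite pair_big_dep /=.
pose h (p : 'I_n * ('I_n * 'I_n)) := [set p.1; p.2.1; p.2.2].
pose A := [set p : 'I_n * ('I_n * 'I_n) |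
  [&& (p.1 < p.2.1)%N, (p.2.1 < p.2.2)%N & triangle G p.1 p.2.1 p.2.2]].
have -> : \sum_(t | triangle_set G t) corner_sum Y t =
          \sum_(t in h @: A) corner_sum Y t.
  apply: eq_bigl => t; apply/idP/imsetP => [tt|[p]].
    have [i [j [k [ij jk E]]]] := set3_sorted (eqP (andP tt).1).
    exists (i, (j, k)) => //; rewrite inE /= ij jk /= -triangle_set3 -?E //;
      rewrite -val_eqE /= neq_ltn ?ij ?jk ?(ltn_trans ij jk) //.
  rewrite inE => /and3P[ij jk tri] ->; rewrite /h triangle_set3 //;
    by rewrite -val_eqE /= neq_ltn ?ij ?jk ?(ltn_trans ij jk).
rewrite big_imset /=; last first.
  move=> [i [j k]] [a [b c]]; rewrite !inE /= => /and3P[ij jk _] /and3P[ab bc _].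
  by move=> /(set3_sorted_inj ij jk ab bc)[-> -> ->].
apply: eq_big => [[i [j k]]|[i [j k]] /= /and3P[ij jk _]]; first by rewrite inE.
rewrite /h /= corner_sum_set3; last 3 first.
- by rewrite -val_eqE /= neq_ltn ij.
- by rewrite -val_eqE /= neq_ltn (ltn_trans ij jk).
- by rewrite -val_eqE /= neq_ltn jk.
by ring.
Qed.

Lemma eq_corner_sum (n : nat) (K : fieldType) (Y Z : {set 'I_n} -> K) (t : {set 'I_n}) :
  #|t| = 3%N ->
  (forall a : {set 'I_n}, a \subset t -> #|a| = 2%N -> Y a = Z a) ->
  corner_sum Y t = corner_sum Z t.
Proof.
move=> t3 YZ; apply: eq_bigr => v vt; congr (_ / _).
  apply: eq_bigr => w; rewrite !inE => /andP[wv wt]; apply: YZ.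
    by rewrite subUset !sub1set vt.
  by rewrite cards2 eq_sym wv.
apply: YZ; first exact: subsetDl.
by have := cardsD1 v t; rewrite t3 vt => -[].
Qed.

Lemma triangle_set_edge (n : nat) (G : {set {set 'I_n}}) (t a : {set 'I_n}) :
  triangle_set G t -> a \subset t -> #|a| = 2%N -> a \in edges G.
Proof.
case/andP=> _ /forall_inP h /subsetP sat /eqP/cards2P[x [y [xy E]]].
have xt : x \in t by apply: sat; rewrite E set21.
have yt : y \in t by apply: sat; rewrite E set22.
by rewrite E; have /forall_inP/(_ y yt)/implyP := h x xt; apply.
Qed.

Section WhiteheadPotential.
Variables (n : nat) (G1 G2 : {set {set 'I_n}}) (v1 v2 v3 v4 : 'I_n).
Hypotheses (tG : triangulation G1) (W : whitehead_move G1 G2 v1 v2 v3 v4).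

Lemma whitehead_new_triangles (t : {set 'I_n}) :
  (triangle_set G2 t && ([set v2; v4] \subset t)) =
  (t == [set v2; v4; v1]) || (t == [set v2; v4; v3]).
Proof.
have [n12 n13 n14 [n23 n24 n34]] := whitehead_neq W.
have [e23 e34 e41 e12] := whitehead_quad_edges (whitehead_sym W tG).
have e24 : [set v2; v4] \in edges G2 by rewrite in_setU (whitehead_new W) orbT.
apply/idP/idP.
  case/andP=> tt s24; have t3 := eqP (andP tt).1.
  have [k kt] : exists k, k \in t :\: [set v2; v4].
    by apply/card_gt0P; rewrite cardsDS // t3 cards2; case: (_ != _).
  have Et : t = [set v2; v4; k].
    apply/esym/eqP; rewrite eqEcard subUset s24 sub1set t3.
    move: kt; rewrite in_setD => /andP[k24 ->] /=.
    by rewrite setUC cardsU1 k24 cards2 n24.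
  move: kt tt; rewrite in_setD in_set2 negb_or Et => /andP[/andP[k2 k4] _].
  rewrite triangle_set3 // 1?eq_sym // => /(whitehead_triangle_apex tG W)[->|->];
    by rewrite eqxx ?orbT.
case/orP=> /eqP->; rewrite subsetUl andbT triangle_set3 // 1?eq_sym // triangleE.
  by rewrite n24 (eq_sym v2) n12 (eq_sym v4) n14 e24 e41 (setUC [set v2]) e12.
by rewrite n24 n23 (eq_sym v4) n34 e24 e23 (setUC [set v4]) e34.
Qed.

Lemma whitehead_common_triangles (t : {set 'I_n}) :
  (triangle_set G2 t && ~~ ([set v2; v4] \subset t)) =
  (triangle_set G1 t && ~~ ([set v1; v3] \subset t)).
Proof.
have [_ n13 _ [_ n24 _]] := whitehead_neq W.
apply/andP/andP => -[tt d]; split.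
- apply/andP; split; first by case/andP: tt.
  apply/forall_inP => x xt; apply/forall_inP => y yt.
  apply/implyP => xy; have s : [set x; y] \subset t by rewrite subUset !sub1set xt.
  have := triangle_set_edge tt s; rewrite cards2 xy => /(_ erefl).
  rewrite (whitehead_edge W) => /orP[/eqP E|/andP[] //].
  by rewrite -E s in d.
- apply/negP => d'; have := triangle_set_edge tt d'; rewrite cards2 n13 => /(_ erefl).
  rewrite (whitehead_edge W) eqxx orbF => /eqP E.
  by rewrite -E d' in d.
- apply/andP; split; first by case/andP: tt.
  apply/forall_inP => x xt; apply/forall_inP => y yt.
  apply/implyP => xy; have s : [set x; y] \subset t by rewrite subUset !sub1set xt.
  have := triangle_set_edge tt s; rewrite cards2 xy => /(_ erefl).
  rewrite (whitehead_edge W) => ->; rewrite andbT.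
  by apply/orP; right; apply: contraNneq d => <-.
- apply/negP => d'; have := triangle_set_edge tt d'; rewrite cards2 n24 => /(_ erefl).
  by rewrite (negPf (whitehead_new_old W tG)).
Qed.

Lemma sum_new_triangles (K : fieldType) (Y : {set 'I_n} -> K) :
  \sum_(t | triangle_set G2 t && ([set v2; v4] \subset t)) corner_sum Y t =
  corner_sum Y [set v2; v4; v1] + corner_sum Y [set v2; v4; v3].
Proof.
have [n12 n13 n14 [n23 n24 n34]] := whitehead_neq W.
rewrite (eq_bigl _ _ whitehead_new_triangles) (bigD1 [set v2; v4; v1]) ?eqxx //=.
congr (_ + _); apply: big_pred1 => t /=.
have [->|_] := eqVneq t [set v2; v4; v1]; last by rewrite andbT.
rewrite andbF; apply/esym/negbTE/eqP => /setP/(_ v1).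
by rewrite !inE eqxx (negPf n12) (negPf n13) (negPf n14).
Qed.

End WhiteheadPotential.

Lemma whitehead_potential (n : nat) (G1 G2 : {set {set 'I_n}}) v1 v2 v3 v4
    (K : fieldType) (Y : {set 'I_n} -> K) :
  triangulation G1 -> whitehead_move G1 G2 v1 v2 v3 v4 ->
  {in edges G1, forall a, Y a != 0} ->
  Y [set v1; v2] * Y [set v2; v3] + Y [set v3; v4] * Y [set v4; v1] != 0 ->
  Y [set v1; v2] * Y [set v4; v1] + Y [set v2; v3] * Y [set v3; v4] != 0 ->
  \sum_(t | triangle_set G2 t)
     corner_sum (fun a => lift_eval Y (whitehead_map v1 v2 v3 v4 a)) t =
  \sum_(t | triangle_set G1 t) corner_sum Y t.
Proof.
move=> tG W Y0 A0 B0; set Z := fun a => _.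
have [n12 n13 n14 [n23 n24 n34]] := whitehead_neq W.
have n1 : (1 < n)%N.
  by move: n12; rewrite -val_eqE /=; have := ltn_ord v1; have := ltn_ord v2; lia.
have tG2 := whitehead_triangulation W n1 tG.
rewrite (bigID (fun t : {set 'I_n} => [set v2; v4] \subset t)) /=.
(* [{v3, v1}] is how the reversed move writes its new diagonal, so that [sum_new_triangles] handles
   both sides. *)
rewrite [RHS](bigID (fun t : {set 'I_n} => [set v3; v1] \subset t)) /=.
congr (_ + _); last first.
  rewrite (setUC [set v3]) (eq_bigl _ _ (whitehead_common_triangles tG W)).
  apply: eq_bigr => t; rewrite -(whitehead_common_triangles tG W) => /andP[tt d].
  apply: eq_corner_sum; first exact: (eqP (andP tt).1).
  move=> a sat _; rewrite /Z whitehead_map_old //.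
  by apply: contraNneq d => <-.
rewrite (sum_new_triangles tG W) (sum_new_triangles tG2 (whitehead_sym W tG)).
have [m12 m23 m34 m41] := whitehead_map_quad W.
rewrite !corner_sum_set3 // 1?eq_sym //.
rewrite (setUC [set v2] [set v1]) (setUC [set v4] [set v3]) (setUC [set v3] [set v1]).
rewrite (setUC [set v1] [set v4]) (setUC [set v3] [set v2]) /Z m12 m23 m34 m41.
rewrite whitehead_map_new /=.
have [/Y0 e12 /Y0 e23 /Y0 e34 /Y0 e41] := whitehead_quad_edges W.
have /Y0 e13 : [set v1; v3] \in edges G1 by rewrite in_setU (whitehead_old W) orbT.
(* Write [A = y1 y2 + y3 y4], [B = y1 y4 + y2 y3], [C = y1 y3 + y2 y4], [P = y1 y2 y3 y4]. The old
   triangles contribute [A/d + d B C/P], the new ones [B/d' + d' A C/P]; these agree for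
   [d' = d B/A]. *)
by field; rewrite e13 e34 e41 e23 e12 A0 B0.
Qed.

Lemma transformation_potential (n : nat) (G' G : {set {set 'I_n}}) T
    (L K : fieldType) (y : {set 'I_n} -> L) (S : K -> L -> Prop) Y :
  (1 < n)%N -> whitehead_point y -> specialization S ->
  triangulation G' -> transformation G' G T -> specializes y S G' Y ->
  \sum_(t | triangle_set G t) corner_sum (fun a => lift_eval Y (T a)) t =
  \sum_(t | triangle_set G' t) corner_sum Y t.
Proof.
move=> n1 wy sS tG' hT sY; elim: hT => [//|G1 G2 T1 v1 v2 v3 v4 h1 IH W].
have tG1 := transformation_triangulation n1 tG' h1.
have s1 := transformation_specializes wy sS tG' h1 sY.
have [A0 B0] := whitehead_den_neq0 wy sS W s1.
rewrite -IH -(whitehead_potential tG1 W (specializes_neq0 n1 wy sS tG1 s1) A0 B0).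
by apply: eq_bigr => t tt; apply: eq_corner_sum => [|a _ _];
  [exact: (eqP (andP tt).1)|exact: lift_eval_subst].
Qed.

(** * A point respected by all Whitehead maps *)

(** Induction on the size; classical reasoning decides irreducibility, which need not be decidable
    over an arbitrary field. *)
Lemma irreducible_factor (K : fieldType) (p : {poly K}) : (1 < size p)%N ->
  exists2 q : {poly K}, irreducible_poly q & q %| p.
Proof.
have [m] := ubnP (size p); elim: m p => // m IHm p /ltnSE pm p1.
have [irr|red] := Classical_Prop.classic (irreducible_poly p).
  by exists p => //; apply: dvdpp.
have p0 : p != 0 by rewrite -size_poly_gt0 ltnW.
have [q [q1 qp nqp]] : exists q : {poly K}, [/\ size q != 1%N, q %| p & ~~ (q %= p)].
  apply: Classical_Prop.NNPP => h; apply: red; split=> // q q1 qp.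
  by apply/negPn/negP => nqp; apply: h; exists q.
have qsize : (size q < size p)%N.
  by rewrite ltn_neqAle dvdp_leq // andbT; apply: contra nqp; rewrite dvdp_size_eqp.
have qgt1 : (1 < size q)%N.
  rewrite ltn_neqAle eq_sym q1 size_poly_gt0.
  by apply: contraNneq p0 => q0; move: qp; rewrite q0 dvd0p.
have [s irrs sq] := IHm q (leq_trans qsize pm) qgt1.
by exists s => //; apply: dvdp_trans qp.
Qed.

(** Adjoins a root of an irreducible factor of [X^n - c]. *)
Lemma root_extension (K : fieldType) (c : K) (n : nat) : (0 < n)%N ->
  exists (L : fieldType) (phi : {rmorphism K -> L}) (z : L), z ^+ n = phi c.
Proof.
move=> n0; have sz : size ('X^n - c%:P) = n.+1 by rewrite size_XnsubC.
have [|q irr qp] := @irreducible_factor K ('X^n - c%:P); first by rewrite sz ltnS.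
have [L _ [z qz _]] := irredp_FAdjoin irr.
exists L, (in_alg L), z; apply/eqP; rewrite -subr_eq0.
have : root (map_poly (in_alg L) ('X^n - c%:P)) z.
  by move: qz; rewrite -!dvdp_XsubCl => /dvdp_trans->; rewrite ?dvdp_map.
by rewrite rmorphB /= map_polyXn map_polyC /= /root !hornerE.
Qed.

(** On a two-element set, the sum minus the maximum is the smaller vertex. *)
Definition vertex_min (n : nat) (a : {set 'I_n}) : nat :=
  (\sum_(i in a) i - \max_(i in a) i)%N.

Lemma vertex_max_min (n : nat) (i j : 'I_n) : (i < j)%N ->
  \max_(k in [set i; j]) (k : nat) = j /\ vertex_min [set i; j] = i.
Proof.
move=> ij; have nij : i != j by rewrite -val_eqE /= neq_ltn ij.
have -> : (\max_(k in [set i; j]) (k : nat) = j)%N.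
  by rewrite big_setU1 ?inE //= big_set1; apply/maxn_idPr/ltnW.
split=> //; rewrite /vertex_min big_setU1 ?inE //= big_set1.
by rewrite big_setU1 ?inE //= big_set1 (maxn_idPr (ltnW ij)) addnK.
Qed.

(** [p, q, r, s] are the sides in cyclic order, [e] and [f] the diagonals. Both sums are required to
    be nonzero because a rotation swaps them. *)
Definition quad_relations (K : fieldType) (p q r s e f : K) : Prop :=
  [/\ p * q + r * s != 0, p * s + q * r != 0 &
      e * (p * s + q * r) = f * (p * q + r * s)].

Lemma quad_relations_rot (K : fieldType) (p q r s e f : K) :
  quad_relations p q r s e f -> quad_relations q r s p f e.
Proof.
case=> h1 h2 h3; have E1 : q * p + r * s = p * q + r * s by ring.
have E2 : q * r + s * p = p * s + q * r by ring.
by split; rewrite ?E1 ?E2.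
Qed.

Lemma quad_relations_rev (K : fieldType) (p q r s e f : K) :
  quad_relations p q r s e f -> quad_relations r q p s f e.
Proof.
case=> h1 h2 h3; have E1 : r * s + q * p = p * q + r * s by ring.
have E2 : r * q + p * s = p * s + q * r by ring.
by split; rewrite ?E1 ?E2.
Qed.

(* The y are, up to the factor z, the reciprocals of the chords x_j - x_i of
   collinear points x_i; for chords of points on a circle or a line the
   exchange relation is Ptolemy's second theorem. *)
Lemma quad_relations_chords (K : fieldType) (z a b c d : K) :
  z != 0 -> b - a != 0 -> c - b != 0 -> d - c != 0 -> d - a != 0 ->
  c - a != 0 -> d - b != 0 -> b - a + (d - c) != 0 ->
  quad_relations (z / (b - a)) (z / (c - b)) (z / (d - c)) (z / (d - a))
                 (z / (c - a)) (z / (d - b)).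
Proof.
move=> z0 ba cb dc da ca db bdac.
(* Both sums factor into [z ^+ 2], one diagonal chord and [b - a + (d - c)], over the product of the
   side chords. That last factor is the only one that is not a chord. *)
have E1 : z / (b - a) * (z / (c - b)) + z / (d - c) * (z / (d - a)) =
    z ^+ 2 * (b - a + (d - c)) * (d - b) /
      ((b - a) * (c - b) * (d - c) * (d - a)).
  by field; rewrite ba cb dc da.
have E2 : z / (b - a) * (z / (d - a)) + z / (c - b) * (z / (d - c)) =
    z ^+ 2 * (b - a + (d - c)) * (c - a) /
      ((b - a) * (c - b) * (d - c) * (d - a)).
  by field; rewrite ba cb dc da.
have D0 : (b - a) * (c - b) * (d - c) * (d - a) != 0 by rewrite !mulf_neq0.
split.
- by rewrite E1 !mulf_neq0 ?invr_eq0 // expf_neq0.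
- by rewrite E2 !mulf_neq0 ?invr_eq0 // expf_neq0.
- by rewrite E1 E2; field; rewrite ba cb dc da ca db.
Qed.

Lemma exists_whitehead_point (n : nat) (F : fieldType) (Q : F) :
  (3 <= n)%N -> Q != 0 ->
  exists (L : fieldType) (iota : {rmorphism F -> L}) (y : {set 'I_n} -> L),
    whitehead_point y /\ \prod_i y (side i) = iota Q.
Proof.
move=> n3 Q0; pose K := {fraction {poly F}}.
pose f (a : {set 'I_n}) : {poly F} := 'X^(\max_(i in a) i) - 'X^(vertex_min a).
have fE (i j : 'I_n) : (i < j)%N -> f [set i; j] = 'X^j - 'X^i.
  by rewrite /f => /vertex_max_min[-> ->].
have f0 (a : {set 'I_n}) : #|a| = 2%N -> f a != 0.
  move=> /eqP/cards2P[i [j [ij ->]]]; wlog lt : i j ij / (i < j)%N.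
    move=> h; have [lt|lt|E] := ltngtP i j; first exact: h.
      by rewrite setUC; apply: h; rewrite // eq_sym.
    by case/eqP: ij; apply: val_inj.
  (* The coefficient of ['X^j] is 1, so the polynomial is nonzero in every characteristic. *)
  rewrite fE //; apply/negP => /eqP/polyP/(_ j).
  rewrite coefB !coefXn coef0 eqxx (gtn_eqF lt) subr0 => /eqP; exact/negP/oner_neq0.
have n0 : (0 < n)%N by lia.
(* The product of [z / g (f (side i))] over the [n] sides is [z ^+ n] over the product of the
   chords; this radicand makes it equal to [Q]. *)
have [L [phi [z hz]]] := root_extension
  (tofrac (Q%:P : {poly F}) * \prod_i tofrac (f (side i)) : K) n0.
pose g : {rmorphism {poly F} -> L} := phi \o @tofrac {poly F}.
have g0 p : p != 0 -> g p != 0 by move=> p0; rewrite /g /= fmorph_eq0 tofrac_eq0.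
have side2 (i : 'I_n) : #|side i| = 2%N by apply: card_side; lia.
have z0 : z != 0.
  have : z ^+ n != 0.
    rewrite hz fmorph_eq0 mulf_neq0 ?tofrac_eq0 ?polyC_eq0 //.
    by apply/prodf_neq0 => i _; rewrite tofrac_eq0 f0.
  by rewrite expf_eq0 n0.
exists L, (g \o polyC), (fun a => z / g (f a)); split; last first.
  rewrite big_split /= prodr_const card_ord hz rmorphM rmorph_prod /= -mulrA -big_split /=.
  by rewrite big1 ?mulr1 // => i _; rewrite mulfV // g0 // f0.
have main (a b c d : 'I_n) : (a < b)%N -> (b < c)%N -> (c < d)%N ->
    quad_relations (z / g (f [set a; b])) (z / g (f [set b; c]))
      (z / g (f [set c; d])) (z / g (f [set a; d]))
      (z / g (f [set a; c])) (z / g (f [set b; d])).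
  move=> ab bc cd; have ac := ltn_trans ab bc; have bd := ltn_trans bc cd.
  have ad := ltn_trans ac cd.
  have gE (i j : 'I_n) : (i < j)%N -> g (f [set i; j]) = g 'X^j - g 'X^i.
    by move=> ij; rewrite fE // rmorphB.
  have h (i j : 'I_n) : (i < j)%N -> g 'X^j - g 'X^i != 0.
    by move=> ij; rewrite -gE // g0 // f0 // cards2 -val_eqE /= neq_ltn ij.
  rewrite !gE //; apply: quad_relations_chords; rewrite ?h //.
  (* As [d] is the largest of the four vertices, the coefficient of ['X^d] is 1. *)
  rewrite -!rmorphB -rmorphD; apply: g0; apply/negP => /eqP/polyP/(_ d).
  rewrite coefD !coefB !coefXn coef0 eqxx !gtn_eqF // !subr0 add0r => /eqP.
  exact/negP/oner_neq0.
pose y a := z / g (f a).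
pose quad (a b c d : 'I_n) := quad_relations (y [set a; b]) (y [set b; c])
  (y [set c; d]) (y [set d; a]) (y [set a; c]) (y [set b; d]).
have sorted (a b c d : 'I_n) : (a < b < c)%N -> (c < d)%N -> quad a b c d.
  by rewrite /quad (setUC [set d]) => /andP[]; apply: main.
have rot a b c d : quad a b c d -> quad b c d a.
  by move/quad_relations_rot; rewrite /quad (setUC [set c] [set a]).
have rev a b c d : quad a b c d -> quad d c b a.
  move/quad_relations_rev; rewrite /quad (setUC [set d] [set c]).
  by rewrite !(setUC [set b]) ![_ :|: [set a]]setUC (setUC [set d] [set b]).
(* Rotations and a reversal bring each of the eight cyclic orders to the sorted one. *)
have cyclic_quad a b c d : cyclic4 a b c d -> quad a b c d.
  rewrite /cyclic4 => /orP[|/orP[|/orP[|/orP[|/orP[|/orP[|/orP[]]]]]]] /andP[h1 h2].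
  - exact: sorted.
  - by apply/rot/rot/rot/sorted.
  - by apply/rot/rot/sorted.
  - by apply/rot/sorted.
  - by apply/rev/sorted.
  - by apply/rev/rot/sorted.
  - by apply/rev/rot/rot/sorted.
  - by apply/rev/rot/rot/rot/sorted.
split.
- by move=> a a2; rewrite mulf_neq0 // invr_eq0 g0 // f0.
- by move=> a b c d /cyclic_quad[].
- by move=> a b c d /cyclic_quad[].
Qed.

(** * Coordinates *)

Section Coordinates.
Variable n : nat.
Hypothesis n3 : (3 <= n)%N.

Lemma side_inj : injective (@side n).
Proof.
move=> i j /eqP; rewrite /side set2_eq => /orP[/andP[/eqP //]|/andP[/eqP h1 /eqP h2]].
move: (val_ordS i) (val_ordS j); rewrite -h1 h2.
have := ltn_ord i; have := ltn_ord j; case: ifP; case: ifP; lia.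
Qed.

Lemma pick_side (i : 'I_n) : [pick j | side i == side j] = Some i.
Proof.
by case: pickP => [j /eqP/side_inj -> //|/(_ i)]; rewrite eqxx.
Qed.

Lemma pick_not_side (a : {set 'I_n}) :
  a \notin sides n -> [pick j | a == side j] = None.
Proof.
by move=> na; case: pickP => // j /eqP E; rewrite E side_in in na.
Qed.

Lemma side_edge (G : {set {set 'I_n}}) (i : 'I_n) : side i \in edges G.
Proof. by rewrite in_setU side_in. Qed.

Lemma cvars_side (G : {set {set 'I_n}}) (i : 'I_n) :
  (i.+1 < n)%N -> side i \in cvars G.
Proof. by move=> h; rewrite in_setU imset_f // inE. Qed.

Lemma cvars_edge (G : {set {set 'I_n}}) (a : {set 'I_n}) :
  a \in cvars G -> a \in edges G.
Proof.
by rewrite !in_setU => /orP[/imsetP[i _ ->]|->]; rewrite ?side_in ?orbT.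
Qed.

Lemma coord_at_ffun (V : nmodType) (G : {set {set 'I_n}}) (f : cvar G -> V) a
    (aG : a \in cvars G) : coord_at (finfun f) a = f (Sub a aG).
Proof. by rewrite /coord_at insubT ffunE. Qed.

Lemma coord_at_val (V : nmodType) (G : {set {set 'I_n}}) (x : {ffun cvar G -> V})
    (v : cvar G) : coord_at x (val v) = x v.
Proof. by rewrite /coord_at valK. Qed.

Lemma last_sideP (i : 'I_n) : ~~ (i.+1 < n)%N ->
  forall j : 'I_n, (j.+1 < n)%N = (j != i).
Proof.
move=> hi j; rewrite -val_eqE /=; have := ltn_ord i; have := ltn_ord j; lia.
Qed.

Section PL.
Variables (R : realFieldType) (r : R) (G : {set {set 'I_n}}).
Variable I : {set 'I_n} -> {set 'I_n}.
Hypothesis tG : triangulation G.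

Lemma eq_u_coords (U V : {set 'I_n} -> R) :
  {in edges G, U =1 V} -> u_coords G I U = u_coords G I V.
Proof.
move=> UV; apply/ffunP => v; rewrite !ffunE !UV ?cvars_edge ?(valP v) //.
by congr (if _ then _ else _ + _); apply: eq_bigr => i _; rewrite UV ?side_edge.
Qed.

(** The last side is not a coordinate; the perimeter relation on [U] recovers its length. *)
Lemma u_side_coords (U : {set 'I_n} -> R) : \sum_i U (side i) = r ->
  forall i, u_side r (u_coords G I U) i = 2%:R * U (side i).
Proof.
move=> sU i.
have E (j : 'I_n) : (j.+1 < n)%N -> coord_at (u_coords G I U) (side j) = 2%:R * U (side j).
  by move=> h; rewrite (coord_at_ffun _ (cvars_side G h)) /= side_in.
rewrite /u_side; case: ifPn => [/E //|hi].
rewrite (eq_bigr _ E) (eq_bigl _ _ (last_sideP hi)) -sU (bigD1 i) //= -mulr_sumr.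
by rewrite mulrDr addrK.
Qed.

Lemma u_edge_coords (U : {set 'I_n} -> R) : \sum_i U (side i) = r ->
  {in edges G, u_edge r I (u_coords G I U) =1 U}.
Proof.
move=> sU a; rewrite /u_edge.
case: (boolP (a \in sides n)) => [/imsetP[i _ ->] _|na].
  by rewrite pick_side u_side_coords // mulKf // pnatr_eq0.
rewrite in_setU (negPf na) /= => aG; rewrite pick_not_side //.
have ac : a \in cvars G by rewrite in_setU aG orbT.
rewrite (coord_at_ffun _ ac) /= (negPf na).
under [X in _ + _ * X]eq_bigr => i _ do rewrite u_side_coords //.
by rewrite -mulr_sumr mulKf ?pnatr_eq0 // opprD opprK addrNK.
Qed.

Lemma u_edge_sum (x : {ffun cvar G -> R}) : \sum_i u_edge r I x (side i) = r.
Proof.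
have hl : (n.-1 < n)%N by lia.
pose l := Ordinal hl; have nl : ~~ (l.+1 < n)%N by rewrite /=; lia.
under eq_bigr => i _ do rewrite /u_edge pick_side.
rewrite -mulr_sumr (bigD1 l) //= {1}/u_side (negPf nl).
under [X in _ + X]eq_bigr => i; first rewrite -(last_sideP nl) => hi.
  by rewrite /u_side hi; over.
by rewrite (eq_bigl _ _ (last_sideP nl)) subrK mulKf // pnatr_eq0.
Qed.

Lemma u_coords_edge (x : {ffun cvar G -> R}) : u_coords G I (u_edge r I x) = x.
Proof.
apply/ffunP => v; rewrite ffunE; have := valP v; rewrite in_setU.
case/orP=> [/imsetP[i]|vG].
  rewrite inE => hi E; rewrite E side_in /u_edge pick_side mulVKf ?pnatr_eq0 //.
  by rewrite /u_side hi -E coord_at_val.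
rewrite (negPf (diag_not_side tG vG)) {1}/u_edge pick_not_side ?(diag_not_side tG) //.
rewrite coord_at_val mulr_sumr opprD opprK.
under [X in _ + X]eq_bigr => i _ do rewrite /u_edge pick_side.
by rewrite addrNK.
Qed.

End PL.

Section Lift.
Variables (K : fieldType) (Q : K) (G : {set {set 'I_n}}).
Variable I : {set 'I_n} -> {set 'I_n}.
Hypothesis tG : triangulation G.

Lemma eq_y_coords (U V : {set 'I_n} -> K) :
  {in edges G, U =1 V} -> y_coords G I U = y_coords G I V.
Proof.
move=> UV; apply/ffunP => v; rewrite !ffunE !UV ?cvars_edge ?(valP v) //.
by congr (if _ then _ else _ * _); apply: eq_bigr => i _; rewrite UV ?side_edge.
Qed.

Section Edge.
Variable U : {set 'I_n} -> K.
Hypotheses (U0 : {in edges G, forall a, U a != 0}) (pU : \prod_i U (side i) = Q).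

(** The product relation plays the part of the perimeter relation; the other sides must be nonzero
    to be divided out. *)
Lemma y_side_coords i : y_side Q (y_coords G I U) i = U (side i).
Proof.
have E (j : 'I_n) : (j.+1 < n)%N -> coord_at (y_coords G I U) (side j) = U (side j).
  by move=> h; rewrite (coord_at_ffun _ (cvars_side G h)) /= side_in.
rewrite /y_side; case: ifPn => [/E //|hi].
rewrite (eq_bigr _ E) (eq_bigl _ _ (last_sideP hi)) -pU (bigD1 i) //= mulfK //.
by apply/prodf_neq0 => j _; rewrite U0 ?side_edge.
Qed.

Lemma y_edge_coords : {in edges G, y_edge Q I (y_coords G I U) =1 U}.
Proof.
move=> a aE; rewrite /y_edge.
case: (boolP (a \in sides n)) => [/imsetP[i _ ->]|na].
  by rewrite pick_side y_side_coords.
move: (aE); rewrite in_setU (negPf na) /= => aG; rewrite pick_not_side //.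
have ac : a \in cvars G by rewrite in_setU aG orbT.
rewrite (coord_at_ffun _ ac) /= (negPf na).
under [X in _ * X]eq_bigr => i _ do rewrite y_side_coords //.
rewrite invfM invrK mulfVK //.
by apply/prodf_neq0 => j _; rewrite U0 ?side_edge.
Qed.

End Edge.

Lemma y_edge_prod (y : {ffun cvar G -> K}) : (forall v, y v != 0) ->
  \prod_i y_edge Q I y (side i) = Q.
Proof.
move=> y0; have hl : (n.-1 < n)%N by lia.
pose l := Ordinal hl; have nl : ~~ (l.+1 < n)%N by rewrite /=; lia.
under eq_bigr => i _ do rewrite /y_edge pick_side.
rewrite (bigD1 l) //= {1}/y_side (negPf nl).
under [X in _ * X]eq_bigr => i; first rewrite -(last_sideP nl) => hi.
  by rewrite /y_side hi; over.
rewrite (eq_bigl _ _ (last_sideP nl)) divfK //.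
apply/prodf_neq0 => j; rewrite -(last_sideP nl) => hj.
by rewrite /coord_at (insubT (mem (cvars G)) (cvars_side G hj)).
Qed.

Lemma y_coords_edge (y : {ffun cvar G -> K}) : Q != 0 -> (forall v, y v != 0) ->
  y_coords G I (y_edge Q I y) = y.
Proof.
(* The side variables multiply to [Q], which is nonzero, so none of them vanishes, the last one
   included. *)
move=> Q0 y0; have s0 i : y_side Q y i != 0.
  have := y_edge_prod y0; under eq_bigr => j _ do rewrite /y_edge pick_side.
  by move=> E; move: Q0; rewrite -{1}E => /prodf_neq0/(_ i isT).
apply/ffunP => v; rewrite ffunE; have := valP v; rewrite in_setU.
case/orP=> [/imsetP[i]|vG].
  rewrite inE => hi E; rewrite E side_in /u_edge /y_edge pick_side.
  by rewrite /y_side hi -E coord_at_val.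
rewrite (negPf (diag_not_side tG vG)) {1}/y_edge pick_not_side ?(diag_not_side tG) //.
rewrite coord_at_val invfM invrK.
under [X in _ * X]eq_bigr => i _ do rewrite /y_edge pick_side.
by rewrite mulfVK //; apply/prodf_neq0.
Qed.

End Lift.
End Coordinates.

(** * Values of rational functions at a point *)

Section MpolySpecialization.
Variables (F L : fieldType) (iota : {rmorphism F -> L}) (m : nat) (z : 'I_m -> L).

(** The value is read off any representation whose denominator does not vanish at [z]; a fraction
    without such a representation has no value. *)
Definition mpoly_spec (x : {fraction {mpoly F[m]}}) (c : L) : Prop :=
  exists N D : {mpoly F[m]},
    [/\ mmap iota z D != 0, x = tofrac N / tofrac D & c = mmap iota z N / mmap iota z D].

Lemma mpoly_spec_tofrac (p : {mpoly F[m]}) : mpoly_spec (tofrac p) (mmap iota z p).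
Proof. by exists p, 1; rewrite !rmorph1 !divr1 oner_neq0. Qed.

Lemma mmap_neq0 (p : {mpoly F[m]}) : mmap iota z p != 0 ->
  tofrac p != 0 :> {fraction {mpoly F[m]}}.
Proof. by apply: contraNneq => /eqP; rewrite tofrac_eq0 => /eqP->; rewrite rmorph0. Qed.

Lemma mpoly_specialization : specialization mpoly_spec.
Proof.
split.
- by have := mpoly_spec_tofrac 1; rewrite !rmorph1.
- move=> _ _ _ _ [N [D [D0 -> ->]]] [N' [D' [D'0 -> ->]]].
  exists (N * D' + N' * D), (D * D'); rewrite !rmorphD !rmorphM mulf_neq0 //=.
  by rewrite !addf_div ?mmap_neq0.
- move=> _ _ _ _ [N [D [D0 -> ->]]] [N' [D' [D'0 -> ->]]].
  by exists (N * N'), (D * D'); rewrite !rmorphM mulf_neq0 //= !mulf_div.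
- move=> _ c c0 [N [D [D0 -> Ec]]]; exists D, N; rewrite Ec !invf_div.
  by split=> //; apply: contraNneq c0 => N0; rewrite Ec N0 mul0r.
- move=> _ c c0 [N [D [D0 -> Ec]]]; rewrite mulf_neq0 ?invr_eq0 ?mmap_neq0 //.
  by apply: contraNneq c0 => N0; rewrite Ec N0 mul0r.
Qed.

End MpolySpecialization.

Section Specialize.
Variables (K L : fieldType) (S : K -> L -> Prop).
Hypothesis sS : specialization S.

Lemma spec_prod (J : finType) (P : pred J) (f : J -> K) (g : J -> L) :
  (forall j, P j -> S (f j) (g j)) -> S (\prod_(j | P j) f j) (\prod_(j | P j) g j).
Proof.
move=> h; elim/big_rec2: _ => [|j c x Pj]; first exact: (spec1 sS).
by apply: (specM sS); apply: h.
Qed.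

Variables (n : nat) (G : {set {set 'I_n}}) (I : {set 'I_n} -> {set 'I_n}).
Hypothesis tG : triangulation G.
Variables (Q : K) (Q' : L) (x : {ffun cvar G -> K}) (z : {ffun cvar G -> L}).
Hypotheses (SQ : S Q Q') (Sx : forall v, S (x v) (z v)) (z0 : forall v, z v != 0).

Lemma spec_coord_at a : a \in cvars G ->
  S (coord_at x a) (coord_at z a) /\ coord_at z a != 0.
Proof. by move=> aG; rewrite /coord_at (insubT (mem (cvars G)) aG). Qed.

Lemma spec_y_side i : S (y_side Q x i) (y_side Q' z i).
Proof.
rewrite /y_side; case: ifP => [h|_]; first exact: (spec_coord_at (cvars_side G h)).1.
apply: (specM sS) => //; apply: (specV sS).
  by apply/prodf_neq0 => j h; apply: (spec_coord_at (cvars_side G h)).2.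
by apply: spec_prod => j h; apply: (spec_coord_at (cvars_side G h)).1.
Qed.

Lemma spec_y_edge : specializes (y_edge Q' I z) S G (y_edge Q I x).
Proof.
move=> a aE; rewrite /y_edge; case: pickP => [i _|na]; first exact: spec_y_side.
have aG : a \in cvars G.
  move: aE; rewrite !in_setU => /orP[/imsetP[i _ E]|->]; last by rewrite orbT.
  by have := na i; rewrite E eqxx.
have [s n0] := spec_coord_at aG.
apply: (specM sS); first exact: (specV sS).
by apply: spec_prod => i _; apply: spec_y_side.
Qed.

End Specialize.

(** * The geometric lift as a map of tori *)

Section LiftMap.
Variables (n : nat) (n3 : (3 <= n)%N) (K L : fieldType) (S : K -> L -> Prop).
Variables (w : {set 'I_n} -> L) (wp : whitehead_point w) (sS : specialization S).
Variables (G G' : {set {set 'I_n}}) (I I' : {set 'I_n} -> {set 'I_n}).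
Hypotheses (tG : triangulation G) (tG' : triangulation G').
Variables (Q : K) (y : {ffun cvar G' -> K}).
Hypotheses (Q0 : Q != 0) (y0 : forall v, y v != 0).
Hypothesis sy : specializes w S G' (y_edge Q I' y).
Variable T : {set 'I_n} -> plexpr {set 'I_n}.
Hypothesis hT : transformation G' G T.

Let n1 : (1 < n)%N := ltnW n3.

(** Passing to coordinates and back preserves edge values that are nonzero and whose product over
    the sides is [Q]: the first comes from the specialization, the second from [T] fixing the
    sides. *)
Lemma lift_map_edge : {in edges G, y_edge Q I (lift_map Q G I' I T y) =1
  fun a => lift_eval (y_edge Q I' y) (T a)}.
Proof.
apply: (y_edge_coords n3).
  exact: (specializes_neq0 n1 wp sS tG (transformation_specializes wp sS tG' hT sy)).
under eq_bigr => i _ do rewrite (transformation_side hT) ?side_in //=.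
exact: (y_edge_prod n3).
Qed.

Lemma lift_map_potential :
  potential Q I (lift_map Q G I' I T y) = potential Q I' y.
Proof.
rewrite !potential_corner_sum -(transformation_potential n1 wp sS tG' hT sy).
apply: eq_bigr => t tt; apply: eq_corner_sum => [|a sat a2].
  exact: (eqP (andP tt).1).
by rewrite lift_map_edge ?(triangle_set_edge tt).
Qed.

Lemma lift_map_cancel T' : transformation G G' T' -> left_inverse G' T T' ->
  lift_map Q G' I I' T' (lift_map Q G I' I T y) = y.
Proof.
move=> hT' [_ inv]; rewrite -[RHS](y_coords_edge n3 I' tG' Q0 y0).
apply: eq_y_coords => a aG'; rewrite -[RHS](inv _ _ _ _ _ wp sS sy) //.
by apply: (transformation_lift_eval hT') => // b; apply: lift_map_edge.
Qed.

End LiftMap.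

Lemma ratvars_neq0 (n : nat) (F : fieldType) (G : {set {set 'I_n}}) v :
  ratvars F G v != 0.
Proof. by rewrite ffunE tofrac_eq0 -msize_poly_eq0 msizeX. Qed.

(** Evaluating the indeterminates at the torus coordinates of [w] gives the edges the values of [w],
    because the side product of [w] is the image of [Q]. *)
Lemma ratvars_specializes (n : nat) (F L : fieldType) (iota : {rmorphism F -> L})
    (w : {set 'I_n} -> L) (Q : F) (G : {set {set 'I_n}}) I :
  (3 <= n)%N -> triangulation G -> whitehead_point w ->
  \prod_i w (side i) = iota Q ->
  exists2 S, specialization S &
    specializes w S G (y_edge (ratconst G Q) I (ratvars F G)).
Proof.
move=> n3 tG wp pw; have n1 := ltnW n3.
have w0 : {in edges G, forall a, w a != 0}.
  by move=> a aG; apply: (wpoint_neq0 wp) (card_edge n1 tG aG).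
pose z := y_coords G I w.
have z0 v : z v != 0.
  have vE := w0 _ (cvars_edge (valP v)).
  rewrite ffunE; case: ifP => // _; rewrite mulf_neq0 ?invr_eq0 //.
  by apply/prodf_neq0 => i _; apply/w0/side_edge.
pose S : ratfun F G -> L -> Prop :=
  mpoly_spec iota (fun k : 'I_#|cvar G| => z (enum_val k)).
exists S; first exact: mpoly_specialization.
move=> a aG; rewrite -(y_edge_coords n3 I w0 pw aG).
apply: (spec_y_edge (S := S)) aG => //; first exact: mpoly_specialization.
  by rewrite -(mmapC (fun k : 'I_#|cvar G| => z (enum_val k)) iota); apply: mpoly_spec_tofrac.
move=> v; rewrite ffunE.
have -> : z v = mmap iota (fun k : 'I_#|cvar G| => z (enum_val k)) 'X_(enum_rank v).
  by rewrite mmapX mmap1U enum_rankK.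
exact: mpoly_spec_tofrac.
Qed.

Lemma pl_map_edge (n : nat) (R : realFieldType) (r : R) (G G' : {set {set 'I_n}}) I I' T
    (x : {ffun cvar G' -> R}) :
  (3 <= n)%N -> triangulation G -> triangulation G' -> transformation G' G T ->
  {in edges G, u_edge r I (pl_map r G I' I T x) =1
    fun a => pl_eval (u_edge r I' x) (T a)}.
Proof.
move=> n3 tG tG' hT; apply: (u_edge_coords n3).
under eq_bigr => i _ do rewrite (transformation_side hT) ?side_in //=.
exact: u_edge_sum.
Qed.

Theorem theorem1p7 (n : nat) (hn : (3 <= n)%N)
    (G G' : {set {set 'I_n}}) (hG : triangulation G) (hG' : triangulation G')
    (I I' : {set 'I_n} -> {set 'I_n})
    (hI : side_choice G I) (hI' : side_choice G' I')
    (R : realFieldType) (r : R) (hr : 0 < r)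
    (F : fieldType) (Q : F) (hQ : Q != 0) :
  (exists T, transformation G' G T) /\
  (forall T, transformation G' G T ->
    (* T maps the polytope of G' onto the polytope of G *)
    [/\ (forall x' : {ffun cvar G' -> R}, in_polytope r I' x' ->
           in_polytope r I (pl_map r G I' I T x')),
        (forall x : {ffun cvar G -> R}, in_polytope r I x ->
           exists2 x' : {ffun cvar G' -> R},
             in_polytope r I' x' & pl_map r G I' I T x' = x),
    (* its geometric lift is a well defined rational map between the tori *)
        (forall a : {set 'I_n}, a \in edges G ->
           let y' := y_edge (ratconst G' Q) I' (ratvars F G') in
           lift_defined y' (T a) && (lift_eval y' (T a) != 0)),
    (* this map is a change of variables: its inverse is the geometric lift of
       a transformation in the opposite direction *)
        (exists2 T', transformation G G' T' &
           lift_map (ratconst G' Q) G' I I' T'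
             (lift_map (ratconst G' Q) G I' I T (ratvars F G')) = ratvars F G' /\
           lift_map (ratconst G Q) G I' I T
             (lift_map (ratconst G Q) G' I I' T' (ratvars F G)) = ratvars F G) &
    (* substituting it into the potential function of G gives that of G' *)
        potential (ratconst G' Q) I
          (lift_map (ratconst G' Q) G I' I T (ratvars F G'))
        = potential (ratconst G' Q) I' (ratvars F G')]).
Proof.
have n1 := ltnW hn.
have [L [iota [w [wp pw]]]] := exists_whitehead_point hn hQ.
have rat0 (H : {set {set 'I_n}}) : ratconst H Q != 0.
  by rewrite tofrac_eq0 mpolyC_eq0.
split.
  (* The path runs from [G'] to the fan and then back along the reversed path of [G]. *)
  have [T1 hT1] := transformation_fan hn hG'.
  have [T2 hT2] := transformation_fan hn hG.
  have [T3 [hT3 _ _]] := transformation_inverse n1 hG hT2.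
  by have [T hT _] := transformation_trans hT1 hT3; exists T.
move=> T hT; have [T' [hT' inv inv']] := transformation_inverse n1 hG' hT.
have [S sS sy] := ratvars_specializes I hn hG wp pw.
have [S' sS' sy'] := ratvars_specializes I' hn hG' wp pw.
(* Stated for an arbitrary pair, since it is applied to [T] and to its inverse. *)
have poly (H H' : {set {set 'I_n}}) J J' U (x : {ffun cvar H' -> R}) :
    triangulation H -> triangulation H' -> transformation H' H U ->
    in_polytope r J' x -> in_polytope r J (pl_map r H J' J U x).
  move=> tH tH' hU /in_polytopeP hx; apply/in_polytopeP => i j k tri.
  have := tri; rewrite triangleE => /and5P[_ _ _ e1 /andP[e2 e3]].
  rewrite !(@pl_map_edge n R r H H' J J' U x hn tH tH' hU) //.
  exact: (transformation_triangle_inequalities n1 tH' hU hx).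
split.
- by move=> x'; apply: poly.
(* The preimage is the image under the inverse transformation. *)
- move=> x hx; exists (pl_map r G' I I' T' x); first exact: poly.
  rewrite -[RHS](u_coords_edge hn r I hG); apply: eq_u_coords => a aG.
  rewrite -[RHS](inv'.1 _ _ a aG).
  by apply: (transformation_pl_eval hT) => // b; apply: pl_map_edge.
- move=> a aG /=; rewrite (transformation_lift_defined wp sS' hG' hT sy') //=.
  exact: (specializes_neq0 n1 wp sS' hG (transformation_specializes wp sS' hG' hT sy')).
- exists T' => //; split.
    exact: (lift_map_cancel hn wp sS' I hG hG' (rat0 G') (@ratvars_neq0 n F G') sy' hT hT' inv).
  exact: (lift_map_cancel hn wp sS I' hG' hG (rat0 G) (@ratvars_neq0 n F G) sy hT' hT inv').
- exact: (lift_map_potential hn wp sS' I hG hG' (@ratvars_neq0 n F G') sy' hT).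
Qed.
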